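(* Let $c\subset Q$ be an irreducible reduced curve, and let $Q^{\log}|_\theta\to Q$ be the fixed-phase circle bundle associated with $\widetilde Z_1$. Set $$P_\theta:=\bigl(Q^{\log}|_\theta\bigr)\big|_c\longrightarrow c.$$ Then the associated complex line bundle $L_\theta$ satisfies $$L_\theta\simeq\mathcal N_{Q/\widetilde Z_1}\big|_c,$$ and $$c_1(P_\theta)=c_1(L_\theta)\in H^2(c;\mathbb Z).$$
   Context: Let $Z_1,Z_2$ be twistor spaces of compact anti-self-dual $4$-manifolds, $\ell_i\subset Z_i$ twistor lines, $\widetilde Z_i=\mathrm{Bl}_{\ell_i}(Z_i)$ with exceptional divisor $Q_i\simeq\mathbb P^1\times\mathbb P^1$, and $Z_0=\widetilde Z_1\cup_Q\widetilde Z_2$ the normal crossings space obtained by gluing $Q_1\simeq Q_2=:Q$ via an isomorphism exchanging rulings; $Z_0$ is the central fibre of a semistable family with local model $t=uv$ along $Q$. For a fixed phase $\theta$, $Q^{\log}|_\theta\to Q$ is the principal $S^1$-bundle obtained by gluing, over semistable charts $uv=t$ in which $\widetilde Z_1=\{u=0\}$, the local bundles over $V\subset Q$ with fibre $\{(\rho_1,\rho_2)\in S^1\times S^1\mid\rho_1\rho_2=e^{i\theta}\}$ (phases of $u,v$), where the circle coordinate is the phase $\eta=\rho_2$ of the local equation $v$ of $Q$ in $\widetilde Z_1$, transforming by $\eta\mapsto(a/|a|)\eta$ when $v\mapsto av$, $a\in\mathcal O_Q^\times$. It is canonically isomorphic (up to isotopy) to the unit circle bundle $S(\mathcal N_{Q/\widetilde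 Z_1})\to Q$. The complex line bundle associated with a principal $S^1$-bundle $P$ is $P\times_{S^1}\mathbb C$; thus $L_\theta=P_\theta\times_{S^1}\mathbb C$. *)

(* Defs.v *)
From HB Require Import structures.
From mathcomp Require Import all_boot all_order all_algebra.
From mathcomp Require Import all_classical all_reals all_analysis.
From mathcomp Require Import complex zify.
Import Order.TTheory GRing.Theory Num.Theory numFieldNormedType.Exports.

Set Implicit Arguments.
Unset Strict Implicit.
Unset Printing Implicit Defensive.

Local Open Scope classical_set_scope.
Local Open Scope ring_scope.
Local Open Scope quotient_scope.

(* The complex numbers, typed as a numFieldType so that they carry the topology
   and the normed structure of MathComp-Analysis. *)
Definition CC (R : realType) : numFieldType := R[i].

Fixpoint iterD (K : numFieldType) (V W : normedModType K) (ds : seq V)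
    (f : V -> W) : V -> W :=
  if ds is d :: ds' then 'D_d (iterD ds' f) else f.

(* All iterated directional derivatives exist and are differentiable: this is
   "C^infinity" for K = R and "holomorphic" for K = C (differentiability is
   then over C). *)
Definition smooth_on (K : numFieldType) (V W : normedModType K) (A : set V)
    (f : V -> W) : Prop :=
  forall (ds : seq V) x, A x -> differentiable (iterD ds f) x.

(* Row-vector convention: 'D_w f x = w *m jac f x. *)
Definition jac (K : numFieldType) n m (f : 'rV[K]_n -> 'rV[K]_m)
    (x : 'rV[K]_n) : 'M[K]_(n, m) :=
  \matrix_(i, j) ('D_(delta_mx 0 i) f x) 0 j.

Record chart (K : numFieldType) (n : nat) (X : topologicalType) := Chart {
  cdom : set X;
  cmap : X -> 'rV[K]_n;
  cinv : 'rV[K]_n -> X;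
  cdom_open : open cdom;
  cimg_open : open (cmap @` cdom);
  cmapK : forall x, cdom x -> cinv (cmap x) = x;
  cmap_cont : forall x, cdom x -> {for x, continuous cmap};
  cinv_cont : forall v, (cmap @` cdom) v -> {for v, continuous cinv}
}.

HB.instance Definition _ K n X := gen_eqMixin (chart K n X).
HB.instance Definition _ K n X := gen_choiceMixin (chart K n X).

Definition cimg K n X (phi : chart K n X) : set 'rV[K]_n :=
  cmap phi @` cdom phi.

Definition transition K n X (phi psi : chart K n X) : 'rV[K]_n -> 'rV[K]_n :=
  cmap psi \o cinv phi.

Definition compatible K n X (phi psi : chart K n X) : Prop :=
  smooth_on (cmap phi @` (cdom phi `&` cdom psi)) (transition phi psi).

Record manifold (K : numFieldType) (n : nat) := Manifold {
  mspace :> topologicalType;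
  atlas : set (chart K n mspace);
  atlas_cover : forall x, exists2 phi, atlas phi & cdom phi x;
  atlas_compat : forall phi psi, atlas phi -> atlas psi -> compatible phi psi;
  mspace_hausdorff : hausdorff_space mspace;
  mspace_countable : @second_countable mspace
}.
Arguments atlas {K n} _.

(* The charts of the maximal atlas. *)
Definition admissible K n (X : manifold K n) (phi : chart K n X) : Prop :=
  forall psi, atlas X psi -> compatible phi psi /\ compatible psi phi.

Section Maps.
Variable K : numFieldType.

(* Meant for open A. *)
Definition smooth_map_on n m (X : manifold K n) (Y : manifold K m) (A : set X)
    (f : X -> Y) : Prop :=
  (forall x, A x -> {for x, continuous f}) /\
  forall phi psi, atlas X phi -> atlas Y psi ->
    smooth_on (cmap phi @` (A `&` cdom phi `&` f @^-1` cdom psi))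
              (cmap psi \o f \o cinv phi).

Definition smooth_fun_on n (X : manifold K n) (W : normedModType K) (A : set X)
    (f : X -> W) : Prop :=
  forall phi, atlas X phi ->
    smooth_on (cmap phi @` (A `&` cdom phi)) (f \o cinv phi).

Definition smooth_from_on (V : normedModType K) n (Y : manifold K n)
    (A : set V) (f : V -> Y) : Prop :=
  (forall v, A v -> {for v, continuous f}) /\
  forall psi, atlas Y psi -> smooth_on (A `&` f @^-1` cdom psi) (cmap psi \o f).

(* A map between subsets is holomorphic (smooth) when it extends locally to a
   holomorphic (smooth) map of the ambient manifolds. *)
Definition smooth_between n m (X : manifold K n) (Y : manifold K m)
    (S : set X) (T : set Y) (f : S -> T) : Prop :=
  forall x : S, exists (U : set X) (F : X -> Y),
    [/\ open U, U (val x), smooth_map_on U F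
      & forall y : S, U (val y) -> F (val y) = val (f y)].

Definition biholomorphic n m (X : manifold K n) (Y : manifold K m)
    (S : set X) (T : set Y) (f : S -> T) : Prop :=
  smooth_between f /\
  exists g : T -> S, [/\ smooth_between g, cancel f g & cancel g f].

Definition immersion n m (X : manifold K n) (Y : manifold K m) (f : X -> Y) :=
  forall phi psi x, atlas X phi -> atlas Y psi -> cdom phi x -> cdom psi (f x) ->
    forall xi, 'D_xi (cmap psi \o f \o cinv phi) (cmap phi x) = 0 -> xi = 0.

Definition closed_embedding n m (X : manifold K n) (Y : manifold K m)
    (f : X -> Y) : Prop :=
  [/\ smooth_map_on setT f, injective f, immersion f
    & forall A, closed A -> closed (f @` A)].

Definition submanifold_at n (X : manifold K n) (S : set X) (d : nat) (x : X) :=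
  exists phi, [/\ admissible phi, cdom phi x
    & forall y, cdom phi y ->
        S y <-> forall i : 'I_n, (d <= i)%N -> cmap phi y 0 i = 0].

End Maps.

(* An oriented Riemannian 4-manifold; the atlas is the oriented atlas, and
   [metric phi] is the matrix of the metric in the chart phi. *)
Record riemannian4 (R : realType) := Riemannian4 {
  rspace :> manifold R 4;
  metric : chart R 4 rspace -> 'rV[R]_4 -> 'M[R]_4;
  oriented : forall phi psi x, atlas rspace phi -> atlas rspace psi ->
    cdom phi x -> cdom psi x -> 0 < \det (jac (transition phi psi) (cmap phi x));
  metric_smooth : forall phi, atlas rspace phi -> smooth_on (cimg phi) (metric phi);
  metric_sym : forall phi v, atlas rspace phi -> cimg phi v ->
    (metric phi v)^T = metric phi v;
  metric_pos : forall phi v (w : 'rV[R]_4), atlas rspace phi -> cimg phi v ->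
    w != 0 -> 0 < (w *m metric phi v *m w^T) 0 0;
  metric_transition : forall phi psi x, atlas rspace phi -> atlas rspace psi ->
    cdom phi x -> cdom psi x ->
    let T := jac (transition phi psi) (cmap phi x) in
    metric phi (cmap phi x) = T *m metric psi (cmap psi x) *m T^T
}.

Section Curvature.
Variables (R : realType) (g : 'rV[R]_4 -> 'M[R]_4).

Definition pd (i : 'I_4) (f : 'rV[R]_4 -> R) (x : 'rV[R]_4) : R :=
  'D_(delta_mx 0 i) f x.

Definition ginv (i j : 'I_4) (x : 'rV[R]_4) : R := invmx (g x) i j.

(* nabla_(d_i) d_j = \sum_k (christoffel k i j) d_k *)
Definition christoffel (k i j : 'I_4) (x : 'rV[R]_4) : R :=
  2^-1 * \sum_l ginv k l x *
    (pd i (fun y => g y j l) x + pd j (fun y => g y i l) x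
     - pd l (fun y => g y i j) x).

(* R(d_i, d_j) d_l = \sum_m (curvature m l i j) d_m *)
Definition curvature (m l i j : 'I_4) (x : 'rV[R]_4) : R :=
  pd i (christoffel m j l) x - pd j (christoffel m i l) x
  + \sum_a (christoffel m i a x * christoffel a j l x
            - christoffel m j a x * christoffel a i l x).

(* g(R(d_i, d_j) d_l, d_k); equal to g_ik g_jl - g_il g_jk on the unit sphere. *)
Definition riem (i j k l : 'I_4) (x : 'rV[R]_4) : R :=
  \sum_m curvature m l i j x * g x m k.

Definition ricci (j l : 'I_4) (x : 'rV[R]_4) : R :=
  \sum_i \sum_k ginv i k x * riem i j k l x.

Definition scal (x : 'rV[R]_4) : R := \sum_j \sum_l ginv j l x * ricci j l x.

Definition weyl (i j k l : 'I_4) (x : 'rV[R]_4) : R :=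
  riem i j k l x
  - 2^-1 * (g x i k * ricci j l x - g x i l * ricci j k x
            + g x j l * ricci i k x - g x j k * ricci i l x)
  + scal x / 6 * (g x i k * g x j l - g x i l * g x j k).

Definition levi_civita (i j k l : 'I_4) : R :=
  \det (\matrix_(r < 4) (delta_mx 0 (nth i [:: i; j; k; l] r) : 'rV[R]_4)).

Definition hodge (alpha : 'I_4 -> 'I_4 -> R) (x : 'rV[R]_4) (i j : 'I_4) : R :=
  2^-1 * Num.sqrt (\det (g x)) *
  \sum_a \sum_b \sum_p \sum_q
    levi_civita i j a b * ginv a p x * ginv b q x * alpha p q.

End Curvature.

(* W^+ = 0, i.e. the Weyl tensor satisfies *W = - W. *)
Definition anti_self_dual (R : realType) (M : riemannian4 R) : Prop :=
  forall phi x, atlas M phi -> cimg phi x -> forall i j k l : 'I_4,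
    let W := weyl (@metric _ M phi) in
    hodge (@metric _ M phi) (fun p q => W p q k l x) x i j = - W i j k l x.

(* J (acting on row vectors on the right) is a g-orthogonal complex structure
   on R^4 inducing the standard orientation. *)
Definition orthogonal_cs (R : realType) (g J : 'M[R]_4) : Prop :=
  [/\ J *m J = - 1%:M, J *m g *m J^T = g
    & forall w1 w2 : 'rV[R]_4,
        0 <= \det (\matrix_(r < 4) nth 0 [:: w1; w1 *m J; w2; w2 *m J] r)].

(* The matrix, on row vectors, of w |-> nabla_v w - dw(v). *)
Definition connection_mx (R : realType) (g : 'rV[R]_4 -> 'M[R]_4)
    (x v : 'rV[R]_4) : 'M[R]_4 :=
  \matrix_(k, j) \sum_i v 0 i * christoffel g j i k x.

(* The Atiyah-Hitchin-Singer almost complex structure at (x, J) on the bundle of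
   orthogonal complex structures.  The tangent vector (v, B) splits into the
   horizontal lift of v and the vertical part A = nabla_v J; the structure maps
   v to Jv and A to J o A (that is, A *m J on row vectors). *)
Definition AHS (R : realType) (g : 'rV[R]_4 -> 'M[R]_4) (x : 'rV[R]_4)
    (J : 'M[R]_4) (vB : 'rV[R]_4 * 'M[R]_4) : 'rV[R]_4 * 'M[R]_4 :=
  let G := connection_mx g x in
  let v := vB.1 in
  let A := vB.2 + (J *m G v - G v *m J) in
  (v *m J, A *m J - (J *m G (v *m J) - G (v *m J) *m J)).

Definition of_re_im (R : realType) n (ab : 'rV[R]_n * 'rV[R]_n) : 'rV[CC R]_n :=
  \row_j ((ab.1 0 j +i* ab.2 0 j)%C : CC R).

(* The twistor space: the bundle of orthogonal complex structures J on the
   tangent spaces of M, with a complex manifold structure inducing the AHS almost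
   complex structure.  [tstr phi z] is the matrix, in the chart phi of M, of the
   complex structure on the tangent space of M at [tproj z]. *)
Record twistor_space (R : realType) (M : riemannian4 R) := TwistorSpace {
  tspace :> manifold (CC R) 3;
  tproj : tspace -> M;
  tstr : chart R 4 M -> tspace -> 'M[R]_4;
  tstr_transition : forall phi psi z, atlas M phi -> atlas M psi ->
    cdom phi (tproj z) -> cdom psi (tproj z) ->
    let T := jac (transition phi psi) (cmap phi (tproj z)) in
    tstr phi z *m T = T *m tstr psi z;
  tstr_cs : forall phi z, atlas M phi -> cdom phi (tproj z) ->
    orthogonal_cs (metric phi (cmap phi (tproj z))) (tstr phi z);
  tstr_bij : forall phi m J, atlas M phi -> cdom phi m ->
    orthogonal_cs (metric phi (cmap phi m)) J ->
    exists! z, tproj z = m /\ tstr phi z = J;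
  tproj_cont : continuous tproj;
  tstr_complex : forall zeta phi, atlas tspace zeta -> atlas M phi ->
    let F ab := let z := cinv zeta (of_re_im ab) in
                (cmap phi (tproj z), tstr phi z) in
    let D := [set ab | cimg zeta (of_re_im ab)
                       /\ cdom phi (tproj (cinv zeta (of_re_im ab)))] in
    smooth_on D F /\
    forall ab, D ab -> forall w : 'rV[R]_3 * 'rV[R]_3,
      ('D_w F ab = 0 -> w = 0) /\
      'D_(- w.2, w.1) F ab = AHS (metric phi) (F ab).1 (F ab).2 ('D_w F ab)
}.

Definition twistor_line (R : realType) (M : riemannian4 R) (Z : twistor_space M)
  (m : M) : set Z := @tproj R M Z @^-1` [set m].
Arguments twistor_line {R M} Z m.

Definition row3 (R : realType) (a b c : CC R) : 'rV[CC R]_3 :=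
  \row_i nth 0 [:: a; b; c] i.

(* pi is an isomorphism off l; over a chart in which l = {y_0 = y_1 = 0}, it is
   {(y, [l_0 : l_1]) | y_0 l_1 = y_1 l_0}, covered by two charts phi0 (l_0 <> 0) and
   phi1 (l_1 <> 0) in which pi is (s, b, w) |-> (s, s b, w), resp. (s b, s, w). *)
Definition is_blowup (R : realType) (Z Zt : manifold (CC R) 3) (l : set Z)
    (pi : Zt -> Z) : Prop :=
  [/\ smooth_map_on setT pi,
      exists sigma : Z -> Zt,
        [/\ smooth_map_on (~` l) sigma,
            forall z, ~ l z -> pi (sigma z) = z
          & forall y, ~ l (pi y) -> sigma (pi y) = y]
    & forall z, l z -> exists (phi : chart (CC R) 3 Z) (phi0 phi1 : chart (CC R) 3 Zt),
        [/\ [/\ admissible phi, admissible phi0, admissible phi1 & cdom phi z],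
            (forall y, cdom phi y ->
              l y <-> cmap phi y 0 0 = 0 /\ cmap phi y 0 1 = 0)
            /\ cdom phi0 `|` cdom phi1 = pi @^-1` cdom phi,
            cimg phi0 = [set v | cimg phi (row3 (v 0 0) (v 0 0 * v 0 1) (v 0 2))]
            /\ (forall y, cdom phi0 y -> let v := cmap phi0 y in
                 cmap phi (pi y) = row3 (v 0 0) (v 0 0 * v 0 1) (v 0 2)),
            cimg phi1 = [set v | cimg phi (row3 (v 0 0 * v 0 1) (v 0 0) (v 0 2))]
            /\ (forall y, cdom phi1 y -> let v := cmap phi1 y in
                 cmap phi (pi y) = row3 (v 0 0 * v 0 1) (v 0 0) (v 0 2))
          & [/\ forall y, cdom phi0 y -> cdom phi1 y <-> cmap phi0 y 0 1 != 0,
                forall y, cdom phi1 y -> cdom phi0 y <-> cmap phi1 y 0 1 != 0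
              & forall y, cdom phi0 y -> cdom phi1 y ->
                  cmap phi1 y 0 1 = (cmap phi0 y 0 1)^-1]]].

Definition exceptional_divisor (R : realType) (Z Zt : manifold (CC R) 3)
    (l : set Z) (pi : Zt -> Z) : set Zt := pi @^-1` l.

Section Gluing.
Variable R : realType.

Definition proportional (a b : 'rV[CC R]_2) : Prop :=
  exists2 c : CC R, c != 0 & b = c *: a.

Definition nonzero_pair : set ('rV[CC R]_2 * 'rV[CC R]_2) :=
  [set ab | ab.1 != 0 /\ ab.2 != 0].

(* An isomorphism P^1 x P^1 -> Q, in homogeneous coordinates, carrying the first
   projection to pi : Q -> l. *)
Definition P1xP1_iso (Z Zt : manifold (CC R) 3) (pi : Zt -> Z) (Q : set Zt)
    (h : 'rV[CC R]_2 * 'rV[CC R]_2 -> Zt) : Prop :=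
  [/\ smooth_from_on nonzero_pair h, h @` nonzero_pair = Q,
      (forall a b a' b', nonzero_pair (a, b) -> nonzero_pair (a', b') ->
         h (a, b) = h (a', b') <-> proportional a a' /\ proportional b b')
    & forall a b b', nonzero_pair (a, b) -> nonzero_pair (a, b') ->
        pi (h (a, b)) = pi (h (a, b'))].

(* y and y' lie on a common line of the first, resp. second, ruling. *)
Definition same_line1 (X : Type) (h : 'rV[CC R]_2 * 'rV[CC R]_2 -> X) (y y' : X) :=
  exists a b b', [/\ nonzero_pair (a, b), nonzero_pair (a, b'),
    y = h (a, b) & y' = h (a, b')].

Definition same_line2 (X : Type) (h : 'rV[CC R]_2 * 'rV[CC R]_2 -> X) (y y' : X) :=
  exists a a' b, [/\ nonzero_pair (a, b), nonzero_pair (a', b),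
    y = h (a, b) & y' = h (a', b)].

Definition ruling_exchanging (Z1 Z2 Zt1 Zt2 : manifold (CC R) 3)
    (pi1 : Zt1 -> Z1) (pi2 : Zt2 -> Z2) (Q1 : set Zt1) (Q2 : set Zt2)
    (f : Q1 -> Q2) : Prop :=
  biholomorphic f /\
  exists h1 h2, [/\ P1xP1_iso pi1 Q1 h1, P1xP1_iso pi2 Q2 h2
    & forall q q' : Q1,
      (same_line1 h1 (val q) (val q') <-> same_line2 h2 (val (f q)) (val (f q'))) /\
      (same_line2 h1 (val q) (val q') <-> same_line1 h2 (val (f q)) (val (f q')))].

(* A chart of the total space X in which t = u v, Zt1 = {u = 0}, Zt2 = {v = 0},
   where u and v are the first two coordinates. *)
Definition semistable_chart (Zt1 Zt2 : manifold (CC R) 3) (X : manifold (CC R) 4)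
    (i1 : Zt1 -> X) (i2 : Zt2 -> X) (t : X -> CC R) (kappa : chart (CC R) 4 X) :=
  admissible kappa /\ forall y, cdom kappa y ->
    [/\ t y = cmap kappa y 0 0 * cmap kappa y 0 1,
        range i1 y <-> cmap kappa y 0 0 = 0
      & range i2 y <-> cmap kappa y 0 1 = 0].

(* A proper family t : X -> {|s| < eps} with smooth total space and central fibre
   Zt1 \cup_Q Zt2, given locally by t = u v along Q and a submersion elsewhere. *)
Definition semistable_family (Zt1 Zt2 : manifold (CC R) 3) (Q1 : set Zt1)
    (Q2 : set Zt2) (f : Q1 -> Q2) (X : manifold (CC R) 4) (t : X -> CC R)
    (i1 : Zt1 -> X) (i2 : Zt2 -> X) : Prop :=
  [/\ smooth_fun_on setT t,
      exists2 eps : CC R, 0 < eps &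
        (forall y, `|t y| < eps) /\
        (forall A : set (CC R), compact A -> A `<=` [set s | `|s| < eps] ->
           compact (t @^-1` A)),
      closed_embedding i1 /\ closed_embedding i2,
      [/\ range i1 `|` range i2 = t @^-1` [set 0],
          forall q : Q1, i1 (val q) = i2 (val (f q))
        & forall y1 y2, i1 y1 = i2 y2 -> Q1 y1]
    & (forall q : Q1, exists2 kappa, semistable_chart i1 i2 t kappa
                                   & cdom kappa (i1 (val q)))
      /\ (forall y, ~ (i1 @` Q1) y -> exists2 kappa : chart (CC R) 4 X,
            admissible kappa & cdom kappa y /\
            forall y', cdom kappa y' ->
              t y' = t y + (cmap kappa y' 0 0 - cmap kappa y 0 0))].

End Gluing.

Section Analytic.
Variables (R : realType) (n : nat) (X : manifold (CC R) n).

Definition analytic_subset (A : set X) : Prop :=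
  forall x, exists (U : set X) (k : nat) (F : 'I_k -> X -> CC R),
    [/\ open U, U x, forall i, smooth_fun_on U (F i)
      & forall y, U y -> A y <-> forall i, F i y = 0].

Definition irreducible_analytic (A : set X) : Prop :=
  [/\ analytic_subset A, A !=set0
    & forall A1 A2, analytic_subset A1 -> analytic_subset A2 ->
        A = A1 `|` A2 -> A = A1 \/ A = A2].

(* Reduced, hence identified with its set of points; the second condition says
   that its dimension is 1. *)
Definition irreducible_curve (A : set X) : Prop :=
  irreducible_analytic A /\
  A `<=` closure [set x | A x /\ submanifold_at A 1 x].

End Analytic.

Definition in_sub (T : Type) (A : set T) (x : T) (Ax : x \in A) : set_type A :=
  exist (fun y => y \in A) x Ax.

Section Circle.
Variable R : realType.

Definition circle : topologicalType := set_type [set z : CC R | `|z| = 1].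

Fact circle1_subproof : (1 : CC R) \in [set z : CC R | `|z| = 1].
Proof. by apply/mem_set => /=; rewrite normr1. Qed.

Definition circle1 : circle := in_sub circle1_subproof.

Fact circleM_subproof (a b : circle) :
  val a * val b \in [set z : CC R | `|z| = 1].
Proof.
by apply/mem_set => /=; rewrite normrM (set_valP a) (set_valP b) mulr1.
Qed.

Definition circleM (a b : circle) : circle := in_sub (circleM_subproof a b).

Fact circleV_subproof (a : circle) : (val a)^-1 \in [set z : CC R | `|z| = 1].
Proof. by apply/mem_set => /=; rewrite normfV (set_valP a) invr1. Qed.

Definition circleV (a : circle) : circle := in_sub (circleV_subproof a).

Lemma circleVM (a : circle) : circleM (circleV a) a = circle1.
Proof.
apply: val_inj => /=; apply: mulVf; rewrite -normr_eq0 (set_valP a).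
exact: oner_neq0.
Qed.

Definition expi (x : R) : CC R := (cos x +i* sin x)%C.

Fact expi_subproof (x : R) : expi x \in [set z : CC R | `|z| = 1].
Proof.
apply/mem_set => /=; rewrite /expi /Num.norm /= cos2Dsin2 sqrtr1 //.
Qed.

Definition circle_expi (x : R) : circle := in_sub (expi_subproof x).

(* A space over B with a fibrewise action of the circle group; a principal
   bundle is one with local sections over which it is trivial. *)
Record circle_space (B : topologicalType) := CircleSpace {
  ctot :> topologicalType;
  cproj : ctot -> B;
  cact : circle -> ctot -> ctot;
  cproj_act : forall a p, cproj (cact a p) = cproj p;
  cact1 : forall p, cact circle1 p = p;
  cactM : forall a b p, cact (circleM a b) p = cact a (cact b p)
}.

(* A family of complex vector spaces over B: a space over B with fibrewise
   addition (meaningful on pairs of points of the same fibre) and scalar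
   multiplication. *)
Record vector_family (B : topologicalType) := VectorFamily {
  vtot :> topologicalType;
  vproj : vtot -> B;
  vadd : vtot -> vtot -> vtot;
  vscale : CC R -> vtot -> vtot;
  vproj_add : forall e e', vproj (vadd e e') = vproj e;
  vproj_scale : forall a e, vproj (vscale a e) = vproj e
}.

Definition vector_family_iso B (E F : vector_family B) : Prop :=
  exists (f : E -> F) (g : F -> E),
    [/\ continuous f, continuous g, cancel f g & cancel g f] /\
    [/\ forall e, vproj (f e) = vproj e,
        forall e e', vproj e = vproj e' -> f (vadd e e') = vadd (f e) (f e')
      & forall a e, f (vscale a e) = vscale a (f e)].

End Circle.

Section Restriction.
Variables (R : realType) (B : topologicalType) (A : set B).

Section CircleRestriction.
Variable P : circle_space R B.

Definition rc_tot : topologicalType := set_type (@cproj _ _ P @^-1` A).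

Fact rc_proj_subproof (p : rc_tot) : cproj (val p) \in A.
Proof. by apply/mem_set; exact: (set_valP p). Qed.

Definition rc_proj (p : rc_tot) : A := in_sub (rc_proj_subproof p).

Fact rc_act_subproof (a : circle R) (p : rc_tot) :
  cact a (val p) \in @cproj _ _ P @^-1` A.
Proof. by apply/mem_set; rewrite /= cproj_act; exact: (set_valP p). Qed.

Definition rc_act (a : circle R) (p : rc_tot) : rc_tot :=
  in_sub (rc_act_subproof a p).

Program Definition restrict_circle : circle_space R A :=
  @CircleSpace R A rc_tot rc_proj rc_act _ _ _.
Next Obligation. by move=> a p; apply: val_inj; rewrite /= cproj_act. Qed.
Next Obligation. by move=> p; apply: val_inj; rewrite /= cact1. Qed.
Next Obligation. by move=> a b p; apply: val_inj; rewrite /= cactM. Qed.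

End CircleRestriction.

Section VectorRestriction.
Variable E : vector_family R B.

Definition rv_tot : topologicalType := set_type (@vproj _ _ E @^-1` A).

Fact rv_proj_subproof (e : rv_tot) : vproj (val e) \in A.
Proof. by apply/mem_set; exact: (set_valP e). Qed.

Definition rv_proj (e : rv_tot) : A := in_sub (rv_proj_subproof e).

Fact rv_add_subproof (e e' : rv_tot) :
  vadd (val e) (val e') \in @vproj _ _ E @^-1` A.
Proof. by apply/mem_set; rewrite /= vproj_add; exact: (set_valP e). Qed.

Definition rv_add (e e' : rv_tot) : rv_tot := in_sub (rv_add_subproof e e').

Fact rv_scale_subproof (a : CC R) (e : rv_tot) :
  vscale a (val e) \in @vproj _ _ E @^-1` A.
Proof. by apply/mem_set; rewrite /= vproj_scale; exact: (set_valP e). Qed.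

Definition rv_scale (a : CC R) (e : rv_tot) : rv_tot :=
  in_sub (rv_scale_subproof a e).

Program Definition restrict_vector : vector_family R A :=
  @VectorFamily R A rv_tot rv_proj rv_add rv_scale _ _.
Next Obligation. by move=> e e'; apply: val_inj; rewrite /= vproj_add. Qed.
Next Obligation. by move=> a e; apply: val_inj; rewrite /= vproj_scale. Qed.

End VectorRestriction.
End Restriction.

Section Associated.
Variables (R : realType) (B : topologicalType) (P : circle_space R B).

Let T : topologicalType := (P * CC R)%type.

(* (a . p, z) ~ (p, a z) *)
Definition assoc_rel (x y : T) : bool :=
  `[< exists a : circle R, y.1 = cact a x.1 /\ x.2 = val a * y.2 >].

Lemma assoc_refl : reflexive assoc_rel.
Proof.
by move=> x; apply/asboolP; exists (circle1 R); rewrite cact1 /= mul1r.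
Qed.

Lemma assoc_symW x y : assoc_rel x y -> assoc_rel y x.
Proof.
move=> /asboolP[a [e1 e2]]; apply/asboolP; exists (circleV a).
rewrite e1 e2 -cactM circleVM cact1; split => //=.
have := congr1 val (circleVM a) => /= h; by rewrite mulrA h mul1r.
Qed.

Lemma assoc_sym : symmetric assoc_rel.
Proof. by move=> x y; apply/idP/idP; exact: assoc_symW. Qed.

Lemma assoc_trans : transitive assoc_rel.
Proof.
move=> y x z /asboolP[a [e1 e2]] /asboolP[b [f1 f2]].
apply/asboolP; exists (circleM b a).
by rewrite f1 e1 e2 f2 cactM /= mulrA (mulrC (val b)).
Qed.

Canonical assoc_equiv := EquivRel assoc_rel assoc_refl assoc_sym assoc_trans.

Definition assoc_tot : topologicalType := quotient_topology {eq_quot assoc_rel}.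

Definition assoc_class (x : T) : assoc_tot := \pi_{eq_quot assoc_rel} x.

Definition assoc_repr (e : assoc_tot) : T := repr (e : {eq_quot assoc_rel}).

Lemma assoc_proj_class x : cproj (assoc_repr (assoc_class x)).1 = cproj x.1.
Proof.
have : assoc_rel x (assoc_repr (assoc_class x)).
  by apply/eqmodP; rewrite /assoc_class /assoc_repr reprK.
by move=> /asboolP[a [-> _]]; rewrite cproj_act.
Qed.

Definition assoc_proj (e : assoc_tot) : B := cproj (assoc_repr e).1.

Definition assoc_scale (a : CC R) (e : assoc_tot) : assoc_tot :=
  let: (p, z) := assoc_repr e in assoc_class (p, a * z).

Definition assoc_add (e e' : assoc_tot) : assoc_tot :=
  let: (p, z) := assoc_repr e in
  assoc_class (p, z + xget 0 [set z' : CC R | assoc_class (p, z') = e']).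

Program Definition associated_line : vector_family R B :=
  @VectorFamily R B assoc_tot assoc_proj assoc_add assoc_scale _ _.
Next Obligation.
move=> e e'; rewrite /assoc_add /assoc_proj; case: (assoc_repr e) => p z.
by rewrite assoc_proj_class.
Qed.
Next Obligation.
move=> a e; rewrite /assoc_scale /assoc_proj; case: (assoc_repr e) => p z.
by rewrite assoc_proj_class.
Qed.

End Associated.

Section Normal.
Variables (R : realType) (n : nat) (X : manifold (CC R) n) (S : set X).

Definition nb_base (phi : chart (CC R) n X) : set S :=
  [set x : S | atlas X phi /\ cdom phi (val x)].

(* Points: tangent vectors xi of X at points of S, written in a chart phi. *)
Definition nb_coord : topologicalType :=
  {phi : chart (CC R) n X & (nb_base phi * 'rV[CC R]_n)%type}.

Definition nb_point (v : nb_coord) : S := val (projT2 v).1.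

Definition nb_derive (v : nb_coord) (f : X -> CC R) : CC R :=
  'D_((projT2 v).2) (f \o cinv (projT1 v)) (cmap (projT1 v) (val (nb_point v))).

Definition vanishing_germ (x : X) (f : X -> CC R) : Prop :=
  exists U : set X, [/\ open U, U x, smooth_fun_on U f
                      & forall y, U y -> S y -> f y = 0].

(* Equality in T_x X / T_x S: T_x S is the common kernel of the differentials at
   x of the holomorphic functions vanishing on S near x. *)
Definition nb_rel (v w : nb_coord) : bool :=
  `[< nb_point v = nb_point w /\
      forall f, vanishing_germ (val (nb_point v)) f ->
        nb_derive v f = nb_derive w f >].

Lemma nb_refl : reflexive nb_rel.
Proof. by move=> v; apply/asboolP. Qed.

Lemma nb_symW v w : nb_rel v w -> nb_rel w v.
Proof.
move=> /asboolP[e h]; apply/asboolP; split=> [|f hf]; first exact: esym.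
by apply/esym/h; rewrite e.
Qed.

Lemma nb_sym : symmetric nb_rel.
Proof. by move=> v w; apply/idP/idP; exact: nb_symW. Qed.

Lemma nb_trans : transitive nb_rel.
Proof.
move=> u v w /asboolP[e h] /asboolP[e' h']; apply/asboolP.
split=> [|f hf]; first exact: etrans e e'.
have hf' : vanishing_germ (val (nb_point u)) f by move: hf; rewrite e.
rewrite (h f hf); exact (h' f hf').
Qed.

Canonical nb_equiv := EquivRel nb_rel nb_refl nb_sym nb_trans.

Definition nb_tot : topologicalType := quotient_topology {eq_quot nb_rel}.

Definition nb_class (v : nb_coord) : nb_tot := \pi_{eq_quot nb_rel} v.

Definition nb_repr (e : nb_tot) : nb_coord := repr (e : {eq_quot nb_rel}).

Definition nb_proj (e : nb_tot) : S := nb_point (nb_repr e).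

Lemma nb_proj_class v : nb_proj (nb_class v) = nb_point v.
Proof.
have : nb_rel v (nb_repr (nb_class v)).
  by apply/eqmodP; rewrite /nb_class /nb_repr reprK.
by move=> /asboolP[-> _].
Qed.

Definition nb_with (v : nb_coord) (xi : 'rV[CC R]_n) : nb_coord :=
  existT _ (projT1 v) ((projT2 v).1, xi).

Definition nb_scale (a : CC R) (e : nb_tot) : nb_tot :=
  let v := nb_repr e in nb_class (nb_with v (a *: (projT2 v).2)).

Definition nb_add (e e' : nb_tot) : nb_tot :=
  let v := nb_repr e in
  nb_class (nb_with v ((projT2 v).2
    + xget 0 [set xi : 'rV[CC R]_n | nb_class (nb_with v xi) = e'])).

Program Definition normal_bundle : vector_family R S :=
  @VectorFamily R S nb_tot nb_proj nb_add nb_scale _ _.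
Next Obligation. by move=> e e'; rewrite /nb_add nb_proj_class. Qed.
Next Obligation. by move=> a e; rewrite /nb_scale nb_proj_class. Qed.

End Normal.

Section FixedPhase.
Variables (R : realType) (Zt1 Zt2 : manifold (CC R) 3) (X : manifold (CC R) 4).
Variables (i1 : Zt1 -> X) (i2 : Zt2 -> X) (t : X -> CC R) (Q : set Zt1).
Variable theta : R.

(* {(rho_1, rho_2) in S^1 x S^1 | rho_1 rho_2 = e^(i theta)} *)
Definition phase_fibre : topologicalType :=
  set_type [set r : circle R * circle R |
    circleM r.1 r.2 = circle_expi theta].

Definition fp_base (kappa : chart (CC R) 4 X) : set Q :=
  [set x : Q | semistable_chart i1 i2 t kappa /\ cdom kappa (i1 (val x))].

Definition fp_coord : topologicalType :=
  {kappa : chart (CC R) 4 X & (fp_base kappa * phase_fibre)%type}.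

Definition fp_point (p : fp_coord) : Q := val (projT2 p).1.

Definition fp_phase (p : fp_coord) : circle R * circle R := val (projT2 p).2.

(* The local equation v of Q in Zt1 given by the semistable chart. *)
Definition local_eq (kappa : chart (CC R) 4 X) (y : Zt1) : CC R :=
  cmap kappa (i1 y) 0 1.

(* a is the value at x of the unit of O_Q by which the local equation changes:
   v' = a v modulo the square of the ideal of Q, i.e. dv' = a dv at x. *)
Definition changes_by (kappa kappa' : chart (CC R) 4 X) (x : Zt1) (a : CC R) :=
  forall phi, atlas Zt1 phi -> cdom phi x -> forall xi,
    'D_xi (local_eq kappa' \o cinv phi) (cmap phi x)
    = a * 'D_xi (local_eq kappa \o cinv phi) (cmap phi x).

(* The gluing: eta' = (a / |a|) eta for eta = rho_2; rho_1 is determined by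
   rho_1 rho_2 = e^(i theta). *)
Definition fp_rel (p q : fp_coord) : bool :=
  `[< fp_point p = fp_point q /\
      exists a : CC R,
        [/\ a != 0, changes_by (projT1 p) (projT1 q) (val (fp_point p)) a
          & val (fp_phase q).2 = a / `|a| * val (fp_phase p).2] >].

Lemma fp_refl : reflexive fp_rel.
Proof.
move=> p; apply/asboolP; split=> //; exists 1; split=> [||].
- exact: oner_neq0.
- by move=> phi _ _ xi; rewrite mul1r.
- by rewrite normr1 divr1 mul1r.
Qed.

Lemma fp_symW p q : fp_rel p q -> fp_rel q p.
Proof.
move=> /asboolP[e [a [a0 h1 h2]]]; apply/asboolP; split=> //.
exists a^-1; split=> [||].
- by rewrite invr_eq0.
- by move=> phi Hphi; rewrite -e => hx xi; rewrite (h1 _ Hphi hx) mulKf.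
- have na0 : `|a| != 0 by rewrite normr_eq0.
  by rewrite h2 normfV invrK mulrA mulrACA mulVf// mulfV// !mul1r.
Qed.

Lemma fp_sym : symmetric fp_rel.
Proof. by move=> p q; apply/idP/idP; exact: fp_symW. Qed.

Lemma fp_trans : transitive fp_rel.
Proof.
move=> q p r /asboolP[e [a [a0 h1 h2]]] /asboolP[e' [b [b0 k1 k2]]].
rewrite -e in k1; apply/asboolP; split; first by rewrite e.
exists (b * a); split=> [||].
- by rewrite mulf_neq0.
- move=> phi Hphi hx xi.
  by rewrite (k1 _ Hphi hx) (h1 _ Hphi hx) mulrA.
- by rewrite k2 h2 normrM invfM mulrA mulrACA.
Qed.

Canonical fp_equiv := EquivRel fp_rel fp_refl fp_sym fp_trans.

Definition fp_tot : topologicalType := quotient_topology {eq_quot fp_rel}.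

Definition fp_class (p : fp_coord) : fp_tot := \pi_{eq_quot fp_rel} p.

Definition fp_repr (e : fp_tot) : fp_coord := repr (e : {eq_quot fp_rel}).

Definition fp_proj (e : fp_tot) : Q := fp_point (fp_repr e).

Lemma fp_repr_class p : fp_rel p (fp_repr (fp_class p)).
Proof. by apply/eqmodP; rewrite /fp_class /fp_repr reprK. Qed.

Lemma fp_proj_class p : fp_proj (fp_class p) = fp_point p.
Proof. by have /asboolP[-> _] := fp_repr_class p. Qed.

Fact phase_rot_subproof (a : circle R) (r : phase_fibre) :
  (circleM (circleV a) (val r).1, circleM a (val r).2) \in
  [set r : circle R * circle R | circleM r.1 r.2 = circle_expi theta].
Proof.
apply/mem_set => /=; apply: etrans (set_valP r); apply: val_inj => /=.
have a0 : val a != 0 by rewrite -normr_eq0 (set_valP a) oner_neq0.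
by rewrite mulrACA mulVf ?mul1r.
Qed.

Definition phase_rot (a : circle R) (r : phase_fibre) : phase_fibre :=
  in_sub (phase_rot_subproof a r).

Definition fp_rot (a : circle R) (p : fp_coord) : fp_coord :=
  existT _ (projT1 p) ((projT2 p).1, phase_rot a (projT2 p).2).

Definition fp_act (a : circle R) (e : fp_tot) : fp_tot :=
  fp_class (fp_rot a (fp_repr e)).

Lemma fp_act_class a p : fp_act a (fp_class p) = fp_class (fp_rot a p).
Proof.
apply/eqmodP; rewrite /= -/(fp_rel _ _); apply: fp_symW.
have /asboolP[e [b [b0 h1 h2]]] := fp_repr_class p.
apply/asboolP; split=> //; exists b; split=> //.
by rewrite /= -/(fp_phase _) h2 mulrCA.
Qed.

Lemma fp_classK e : fp_class (fp_repr e) = e.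
Proof. exact: reprK. Qed.

Lemma phase_rot1 r : phase_rot (circle1 R) r = r.
Proof.
apply: val_inj => /=; rewrite [RHS]surjective_pairing.
by congr (_, _); apply: val_inj; rewrite /= ?invr1 mul1r.
Qed.

Lemma phase_rotM a b r : phase_rot (circleM a b) r = phase_rot a (phase_rot b r).
Proof.
apply: val_inj => /=; congr (_, _); apply: val_inj => /=.
  by rewrite invfM mulrA.
by rewrite mulrA.
Qed.

Lemma fp_rot1 p : fp_rot (circle1 R) p = p.
Proof. by case: p => k [x r]; rewrite /fp_rot phase_rot1. Qed.

Lemma fp_rotM a b p : fp_rot (circleM a b) p = fp_rot a (fp_rot b p).
Proof. by case: p => k [x r]; rewrite /fp_rot phase_rotM. Qed.

Program Definition fixed_phase_bundle : circle_space R Q :=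
  @CircleSpace R Q fp_tot fp_proj fp_act _ _ _.
Next Obligation. by move=> a p; rewrite /fp_act fp_proj_class. Qed.
Next Obligation. by move=> p; rewrite -[p in LHS]fp_classK fp_act_class fp_rot1 fp_classK. Qed.
Next Obligation.
by move=> a b p; rewrite -(fp_classK p) !fp_act_class fp_rotM.
Qed.

End FixedPhase.

(* Cech cocycles of covers (U_x)_x of X indexed by the points of X, with x in
   U_x: these covers are cofinal among all open covers of X. *)
Record pointed_cover (X : topologicalType) := PointedCover {
  cov :> X -> set X;
  cov_open : forall x, open (cov x);
  cov_mem : forall x, cov x x
}.

Definition locally_constant_on (X : topologicalType) (A : set X) (f : X -> int) :=
  forall p, A p -> \forall q \near p, f q = f p.

Record cech2 (X : topologicalType) := Cech2 {
  c2cov : pointed_cover X;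
  c2fun : X -> X -> X -> X -> int;
  c2const : forall i j k,
    locally_constant_on (c2cov i `&` c2cov j `&` c2cov k) (c2fun i j k);
  c2cocycle : forall i j k l p,
    c2cov i p -> c2cov j p -> c2cov k p -> c2cov l p ->
    c2fun j k l p - c2fun i k l p + c2fun i j l p - c2fun i j k p = 0
}.

HB.instance Definition _ X := gen_eqMixin (cech2 X).
HB.instance Definition _ X := gen_choiceMixin (cech2 X).

Section CechH2.
Variable X : topologicalType.

(* Equality in the direct limit: the cocycles become cohomologous on some common
   refinement W, with refinement maps r and s. *)
Definition cohomologous (m n : cech2 X) : bool :=
  `[< exists (W : pointed_cover X) (r s : X -> X) (h : X -> X -> X -> int),
      [/\ forall i, W i `<=` c2cov m (r i), forall i, W i `<=` c2cov n (s i),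
          forall i j, locally_constant_on (W i `&` W j) (h i j)
        & forall i j k p, W i p -> W j p -> W k p ->
            c2fun m (r i) (r j) (r k) p - c2fun n (s i) (s j) (s k) p
            = h j k p - h i k p + h i j p] >].

Lemma cohomologous_refl : reflexive cohomologous.
Proof.
move=> m; apply/asboolP; exists (c2cov m), id, id, (fun _ _ _ => 0).
split=> [i p //|i p //|i j p _|i j k p _ _ _]; first exact: nearW.
by rewrite subrr; lia.
Qed.

Lemma cohomologous_symW m n : cohomologous m n -> cohomologous n m.
Proof.
move=> /asboolP[W [r [s [h [h1 h2 h3 h4]]]]]; apply/asboolP.
exists W, s, r, (fun i j p => - h i j p); split=> //.
- by move=> i j p Wp; near do congr (- _); apply: h3.
- by move=> i j k p Wi Wj Wk; have := h4 i j k p Wi Wj Wk; lia.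
Unshelve. all: by end_near. Qed.

Lemma cohomologous_sym : symmetric cohomologous.
Proof. by move=> m n; apply/idP/idP; exact: cohomologous_symW. Qed.

Program Definition coverI (U V : pointed_cover X) : pointed_cover X :=
  @PointedCover X (fun x => U x `&` V x) _ _.
Next Obligation. by move=> U V x; apply: openI; exact: cov_open. Qed.
Next Obligation. by move=> U V x; split; exact: cov_mem. Qed.

Lemma cohomologous_trans : transitive cohomologous.
Proof.
move=> n m l /asboolP[W [r [s [h [a1 a2 a3 a4]]]]].
move=> /asboolP[V [u [w [g [b1 b2 b3 b4]]]]]; apply/asboolP.
exists (coverI W V), r, w.
exists (fun i j p => h i j p + g i j p
  + (c2fun n (s i) (s j) (u j) p - c2fun n (s i) (u i) (u j) p)).
split=> /=.
- by move=> i p [Wp _]; exact: a1.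
- by move=> i p [_ Vp]; exact: b2.
- move=> i j p [[Wi Vi] [Wj Vj]].
  have H1 := a3 i j p (conj Wi Wj); have H2 := b3 i j p (conj Vi Vj).
  have H3 := c2const (conj (conj (a2 _ _ Wi) (a2 _ _ Wj)) (b1 _ _ Vj)).
  have H4 := c2const (conj (conj (a2 _ _ Wi) (b1 _ _ Vi)) (b1 _ _ Vj)).
  near=> q.
  have -> : h i j q = h i j p by near: q.
  have -> : g i j q = g i j p by near: q.
  have -> : c2fun n (s i) (s j) (u j) q = c2fun n (s i) (s j) (u j) p by near: q.
  by have -> : c2fun n (s i) (u i) (u j) q = c2fun n (s i) (u i) (u j) p by near: q.
- move=> i j k p [Wi Vi] [Wj Vj] [Wk Vk].
  have E1 := a4 i j k p Wi Wj Wk; have E2 := b4 i j k p Vi Vj Vk.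
  have si := a2 _ _ Wi; have sj := a2 _ _ Wj; have sk := a2 _ _ Wk.
  have ui := b1 _ _ Vi; have uj := b1 _ _ Vj; have uk := b1 _ _ Vk.
  have C1 := c2cocycle si sj sk uk; have C2 := c2cocycle si sj uj uk.
  have C3 := c2cocycle si ui uj uk; lia.
Unshelve. all: by end_near. Qed.

Canonical cohomologous_equiv :=
  EquivRel cohomologous cohomologous_refl cohomologous_sym cohomologous_trans.

Definition H2 := {eq_quot cohomologous}.

Program Definition cech2_zero : cech2 X :=
  @Cech2 X (@PointedCover X (fun=> setT) _ _) (fun _ _ _ _ => 0) _ _.
Next Obligation. by move=> x; exact: openT. Qed.
Next Obligation. by []. Qed.
Next Obligation. by move=> i j k p _; exact: nearW. Qed.
Next Obligation. by []. Qed.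

Definition H2_class (m : cech2 X) : H2 := \pi_H2 m.

End CechH2.

Section Chern.
Variables (R : realType) (B : topologicalType).

(* m is the image of the class of P under the connecting homomorphism of
   0 -> Z -> R -> S^1 -> 0: with local sections s_j = e^(2 pi i l_ij) s_i, it is
   l_jk - l_ik + l_ij. *)
Definition circle_cocycle (P : circle_space R B) (m : cech2 B) : Prop :=
  exists (s : B -> B -> P) (l : B -> B -> B -> R),
    [/\ forall i p, c2cov m i p -> cproj (s i p) = p /\ {for p, continuous (s i)},
        forall i j p, c2cov m i p -> c2cov m j p ->
          s j p = cact (circle_expi (2 * pi * l i j p)) (s i p)
          /\ {for p, continuous (l i j)}
      & forall i j k p, c2cov m i p -> c2cov m j p -> c2cov m k p ->
          (c2fun m i j k p)%:~R = l j k p - l i k p + l i j p].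

Definition exp2pii (z : CC R) : CC R :=
  ((expR (- (2 * pi * complex.Im z)))%:C)%C * expi (2 * pi * complex.Re z).

(* The same for 0 -> Z -> C -> C^* -> 0 and nowhere vanishing local sections. *)
Definition line_cocycle (L : vector_family R B) (m : cech2 B) : Prop :=
  exists (s : B -> B -> L) (l : B -> B -> B -> CC R),
    [/\ forall i p, c2cov m i p ->
          [/\ vproj (s i p) = p, s i p <> vscale 0 (s i p)
            & {for p, continuous (s i)}],
        forall i j p, c2cov m i p -> c2cov m j p ->
          s j p = vscale (exp2pii (l i j p)) (s i p) /\ {for p, continuous (l i j)}
      & forall i j k p, c2cov m i p -> c2cov m j p -> c2cov m k p ->
          (c2fun m i j k p)%:~R = l j k p - l i k p + l i j p].

(* For a bundle over a paracompact Hausdorff base, the class so obtained exists and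
   is unique. *)
Definition c1_circle (P : circle_space R B) : H2 B :=
  xget (H2_class (cech2_zero B))
    [set c | exists2 m, circle_cocycle P m & c = H2_class m].

Definition c1_line (L : vector_family R B) : H2 B :=
  xget (H2_class (cech2_zero B))
    [set c | exists2 m, line_cocycle L m & c = H2_class m].

End Chern.

(* Main.v *)
Require Import Defs.
From HB Require Import structures.
From mathcomp Require Import all_boot all_order all_algebra.
From mathcomp Require Import all_classical all_reals all_analysis.
From mathcomp Require Import complex.
Import Order.TTheory GRing.Theory Num.Theory numFieldNormedType.Exports.

Set Implicit Arguments.
Unset Strict Implicit.
Unset Printing Implicit Defensive.

Local Open Scope classical_set_scope.
Local Open Scope ring_scope.

(** Let kappa run over the semistable charts, with coordinates (u, v) such that
    t = u v, and let U_kappa be the locus of Q where kappa is defined. Over U_kappa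
    both bundles have a coordinate: on the normal bundle N it is dv, and on the
    line bundle L associated with the fixed-phase bundle it is [p, z] |-> eta z,
    where eta is the phase of p in kappa. Another chart gives a local equation v'
    with dv' = a dv along Q. Then the coordinate of N is multiplied by a, while
    that of L is multiplied by a / |a|, by the gluing of the fixed-phase bundle.
    The two cocycles differ by the positive functions |a|, which a Hermitian norm
    on N absorbs: if n_kappa is the norm of the normal vector with coordinate 1 in
    kappa, then multiplying the coordinate of L by 1 / n_kappa defines a linear
    isomorphism of L with N independent of kappa ([line_iso_of_norm]). Since Q is
    compact and Hausdorff, a norm is obtained by adding finitely many functions
    |dv|, cut off by bump functions ([norm_exists]).

    That dv is a coordinate on N rests on three facts. The charts of the blow-up
    present Q as the zero set of a first coordinate y_0 ([blowup_adapted]), so that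
    every function vanishing on Q has a differential proportional to dy_0
    ([derive_conormal]). The differential dv does not vanish at the points of Q,
    because the first component is immersed in the hypersurface u = 0
    ([second_coord_nondegenerate]). Finally dv varies continuously with the point
    ([derive_map_coord_cont]). It follows that a exists, is unique and continuous,
    and that both bundles are locally trivial ([fixed_phase_triv],
    [normal_triv]); everything is then restricted to c.

    As for the Chern classes, local sections s of P give nowhere vanishing sections
    [s, 1] of L with the same transition functions, and nowhere vanishing sections
    [q, z] of L give sections (z / |z|) q of P, whose transition functions are the
    phases of those of L. On logarithms these operations are the inclusion of the
    real numbers in the complex numbers and the real part, and neither changes the
    integral cocycle ([c1_associated_line]). *)

(** * Continuity at a point, quotients and subspaces *)

Section Topology.

Lemma near_continuous (S T : topologicalType) (f g : S -> T) x :
  (\forall y \near x, f y = g y) -> {for x, continuous f} ->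
  {for x, continuous g}.
Proof.
move=> fg cf; have fgx : f x = g x := nbhs_singleton fg.
move: cf; rewrite /prop_for /continuous_at fgx; apply: cvg_trans.
exact: near_eq_cvg.
Qed.

Lemma continuous_at_eq_on (S T : topologicalType) (f g : S -> T) x (U : set S) :
  nbhs x U -> (forall y, U y -> f y = g y) -> {for x, continuous f} ->
  {for x, continuous g}.
Proof. by move=> xU fg; apply: near_continuous; exact: filterS xU. Qed.

Lemma continuous_at_eq (S T : topologicalType) (f g : S -> T) x :
  f =1 g -> {for x, continuous f} -> {for x, continuous g}.
Proof. by move=> /funext ->. Qed.

Lemma nbhs_preimage_open (S T : topologicalType) (f : S -> T) x (U : set T) :
  {for x, continuous f} -> open U -> U (f x) -> nbhs x (f @^-1` U).
Proof. by move=> cf oU Ux; apply: cf; exact: open_nbhs_nbhs. Qed.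

Lemma continuous_at_comp (S T U : topologicalType) (f : S -> T) (g : T -> U) x :
  {for x, continuous f} -> {for f x, continuous g} ->
  {for x, continuous (fun y => g (f y))}.
Proof. by move=> cf cg; exact: continuous_comp. Qed.

Lemma continuous_at_pair (S T U : topologicalType) (f : S -> T) (g : S -> U) x :
  {for x, continuous f} -> {for x, continuous g} ->
  {for x, continuous (fun y => (f y, g y) : (T * U)%type)}.
Proof. by move=> cf cg; exact: cvg_pair. Qed.

Lemma continuous_at_fst (S T : topologicalType) (x : S * T) :
  {for x, continuous (@fst S T)}.
Proof. by case: x => a b; exact: cvg_fst. Qed.

Lemma continuous_at_snd (S T : topologicalType) (x : S * T) :
  {for x, continuous (@snd S T)}.
Proof. by case: x => a b; exact: cvg_snd. Qed.

Lemma continuous_val (T : topologicalType) (A : set T) :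
  continuous (fun x : A => val x).
Proof. by move=> x; exact: initial_continuous. Qed.

Lemma continuous_to_val (S T : topologicalType) (A : set T) (f : S -> A) x :
  {for x, continuous (fun y => val (f y))} -> {for x, continuous f}.
Proof.
move=> cf U [V [[W oW <-] Wfx WU]]; apply: filterS WU _.
by apply: cf; exact: open_nbhs_nbhs.
Qed.

(** [insubd a0] is a total function that inverts the inclusion near each point of
    the open set A, so that maps into A can be written down without carrying
    membership proofs. *)
Lemma continuous_insubd (T : topologicalType) (A : set T) (a0 : A) x :
  open A -> A x -> {for x, continuous (fun y => insubd a0 y : A)}.
Proof.
move=> oA Ax; apply: continuous_to_val; apply: (@near_continuous _ _ id).
  near=> y; rewrite val_insubd mem_set //.
  by near: y; exact: open_nbhs_nbhs.
exact: cvg_id.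
Unshelve. all: by end_near. Qed.

(** The projections to a quotient type and to its topological copy are locked
    separately, so that they agree only after unlocking. *)
Lemma pi_quotient_topologyE (T : topologicalType) (Q : quotType T) (x : T) :
  (\pi_(quotient_topology Q) x)%qT = (\pi_Q x)%qT.
Proof. by rewrite !unlock. Qed.

Lemma open_quotient (T : topologicalType) (Q : quotType T)
    (U : set (quotient_topology Q)) :
  open [set x : T | U (\pi_Q x)%qT] -> open U.
Proof.
move=> oU; rewrite /open /= /quotient_open; congr open : oU.
by apply/seteqP; split=> x /=; rewrite pi_quotient_topologyE.
Qed.

Lemma open_preimage_at (S T : topologicalType) (f : S -> T) (U : set T) :
  open U -> (forall x, U (f x) -> {for x, continuous f}) -> open (f @^-1` U).
Proof.
move=> oU cf; rewrite openE => x Ux; apply: (cf x Ux).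
exact: open_nbhs_nbhs.
Qed.

Lemma continuous_pi_quotient (T : topologicalType) (Q : quotType T) :
  continuous (fun x : T => (\pi_Q x)%qT : quotient_topology Q).
Proof.
move=> x; apply: (@near_continuous _ _ (\pi_(quotient_topology Q)%qT)).
  by apply: nearW => y; rewrite pi_quotient_topologyE.
exact: pi_continuous.
Qed.

(** Restricting to an open set U of the quotient allows for functions such as
    the coordinates of a bundle, which are continuous over part of the base only. *)
Lemma quotient_continuous_at (T S : topologicalType) (Q : quotType T)
    (U : set (quotient_topology Q)) (f : quotient_topology Q -> S) :
  open U ->
  (forall x, U (\pi_Q%qT x) -> {for x, continuous (fun y => f (\pi_Q%qT y))}) ->
  forall e, U e -> {for e, continuous f}.
Proof.
move=> oU cf e Ue V; rewrite nbhsE => -[W [oW Wfe] WV].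
rewrite /= nbhsE; exists (U `&` f @^-1` W); last by move=> y [_ /WV].
split=> //; rewrite /open /= /quotient_open openE => x /=.
rewrite pi_quotient_topologyE => -[Ux Wx].
have xW : nbhs x ((fun y => f (\pi_Q%qT y)) @^-1` W) :=
  cf x Ux W (open_nbhs_nbhs (conj oW Wx)).
have xU : nbhs x ((fun y => \pi_Q%qT y) @^-1` U) :=
  continuous_pi_quotient (open_nbhs_nbhs (conj oU Ux)).
apply: filterS (filterI xU xW) => y /=.
by rewrite pi_quotient_topologyE.
Qed.

Lemma continuous_at_existT (I : choiceType) (T : I -> topologicalType)
    (S : topologicalType) (f : {i & T i} -> S) i (x : T i) :
  {for x, continuous (fun y => f (existT T i y))} ->
  {for existT T i x, continuous f}.
Proof. by move=> cf V fV; exact: cf. Qed.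

(** A cluster point of the image of a filter is the image of a point z; since
    the neighbourhoods of z come from the target, z is a cluster point of the
    filter itself. *)
Lemma compact_of_embedding (S T : topologicalType) (f : S -> T) :
  (forall x B, nbhs x B -> exists2 C, nbhs (f x) C & f @^-1` C `<=` B) ->
  compact (range f) -> compact [set: S].
Proof.
move=> hf cf F FF _.
have [|_ [[z _ <-] cz]] := cf (f @ F) _.
  by apply: (@filterS _ F _ setT) filterT => x _; exists x.
exists z; split=> // A B FA zB.
have [C zC CB] := hf z B zB.
have [|y [[x Ax <-] Cy]] := cz (f @` A) C _ zC.
  by apply: (@filterS _ F _ A) FA => x Ax; exists x.
by exists x; split=> //; exact: CB.
Qed.

Lemma compact_set_type (T : topologicalType) (A : set T) :
  compact A -> compact [set: A].
Proof.
move=> cA; apply: (@compact_of_embedding _ _ (fun x : A => val x)).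
  move=> x B [V [[W oW <-] Wx WB]]; exists W => //.
  exact: open_nbhs_nbhs.
rewrite (_ : range _ = A) // eqEsubset; split=> [_ [x _ <-]|x Ax].
  exact: set_valP.
by exists (in_sub (mem_set Ax)).
Qed.

Lemma hausdorff_set_type (T : topologicalType) (A : set T) :
  hausdorff_space T -> hausdorff_space A.
Proof.
move=> hT x y cxy; apply: val_inj; apply: hT => B C xB yC.
have [|z [Bz Cz]] := cxy (val @^-1` B) (val @^-1` C) _ (continuous_val yC).
  exact: (continuous_val xB).
by exists (val z).
Qed.

Lemma continuous_atM (K : numFieldType) (S : topologicalType) (f g : S -> K) x :
  {for x, continuous f} -> {for x, continuous g} ->
  {for x, continuous (fun y => f y * g y)}.
Proof. by move=> cf cg; exact: continuousM. Qed.

Lemma continuous_atD (K : numFieldType) (S : topologicalType) (f g : S -> K) x :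
  {for x, continuous f} -> {for x, continuous g} ->
  {for x, continuous (fun y => f y + g y)}.
Proof. by move=> cf cg; exact: (@continuousD K K^o). Qed.

Lemma continuous_atV (K : numFieldType) (S : topologicalType) (f : S -> K) x :
  f x != 0 -> {for x, continuous f} -> {for x, continuous (fun y => (f y)^-1)}.
Proof. by move=> f0 cf; exact: continuousV. Qed.

Lemma continuous_at_sum (K : numFieldType) (S : topologicalType) (J : Type)
    (s : seq J) (f : J -> S -> K) x :
  (forall j, {for x, continuous (f j)}) ->
  {for x, continuous (fun y => \sum_(j <- s) f j y)}.
Proof.
move=> fc; elim: s => [|j s IH].
  apply: (@continuous_at_eq _ _ (fun=> 0)) => [y|]; first by rewrite big_nil.
  exact: cst_continuous.
apply: (@continuous_at_eq _ _ (fun y => f j y + \sum_(k <- s) f k y)) => [y|].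
  by rewrite big_cons.
exact: continuous_atD.
Qed.

Lemma near_neq0 (K : numFieldType) (S : topologicalType) (f : S -> K) x :
  f x != 0 -> {for x, continuous f} -> \forall y \near x, f y != 0.
Proof. by move=> f0 cf; exact: (@cvgr_neq0 _ _ _ (nbhs x) _ f (f x) cf). Qed.

End Topology.

(** * Complex numbers and phases *)

Section ComplexNumbers.
Variable R : realType.

Definition Creal (x : R) : CC R := (x%:C)%C.

Lemma norm_Creal (x : R) : `|Creal x| = Creal `|x|.
Proof. by rewrite /Creal [LHS]normc_def /= expr0n addr0 sqrtr_sqr. Qed.

Lemma CrealB (x y : R) : Creal x - Creal y = Creal (x - y).
Proof. by rewrite /Creal rmorphB. Qed.

Lemma Creal_gt0 (x : R) : (0 < Creal x) = (0 < x).
Proof. exact: ltcR. Qed.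

Lemma Creal_lt (x y : R) : (Creal x < Creal y) = (x < y).
Proof. exact: ltcR. Qed.

Lemma Creal_le (x y : R) : (Creal x <= Creal y) = (x <= y).
Proof. exact: lecR. Qed.

Lemma CC_gt0P (e : CC R) : 0 < e -> exists2 r : R, 0 < r & e = Creal r.
Proof.
case: e => a b e0; have : (0 : R[i]) < (a +i* b)%C by [].
rewrite ltcE /= => /andP[/eqP b0 a0].
by exists a => //; rewrite /Creal; congr (_ +i* _)%C.
Qed.

Lemma continuous_Creal : continuous Creal.
Proof.
move=> x; apply/cvgrPdist_lt => e /CC_gt0P[r r0 ->]; near=> y.
rewrite CrealB norm_Creal Creal_lt; near: y.
exact: (@cvgr_dist_lt _ _ _ (nbhs x) _ id x (@cvg_id _ _) r r0).
Unshelve. all: by end_near. Qed.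

Lemma ler_norm_Re (z : CC R) : Creal `|complex.Re z| <= `|z|.
Proof.
have -> : `|z| = Creal (Num.sqrt (complex.Re z ^+ 2 + complex.Im z ^+ 2)).
  exact: normc_def.
rewrite Creal_le -sqrtr_sqr ler_wsqrtr //.
by rewrite lerDl sqr_ge0.
Qed.

Lemma ReB (z w : CC R) : complex.Re (z - w) = complex.Re z - complex.Re w.
Proof. by case: z w => [? ?] [? ?]. Qed.

Lemma ReD (z w : CC R) : complex.Re (z + w) = complex.Re z + complex.Re w.
Proof. by case: z w => [? ?] [? ?]. Qed.

Lemma continuous_Re : continuous (fun z : CC R => complex.Re z).
Proof.
move=> z; apply/(@cvgrPdist_lt _ _ _ (nbhs z)) => e e0; near=> y.
rewrite -Creal_lt; rewrite -ReB.
apply: le_lt_trans (ler_norm_Re _) _; near: y.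
have e0' : 0 < Creal e by rewrite Creal_gt0.
exact: (@cvgr_dist_lt _ _ _ (nbhs z) _ id z (@cvg_id _ _) _ e0').
Unshelve. all: by end_near. Qed.

Lemma exp2pii_Creal (x : R) : exp2pii (Creal x) = expi (2 * pi * x).
Proof. by rewrite /exp2pii /= mulr0 oppr0 expR0 mul1r. Qed.

Lemma norm_expi (x : R) : `|expi x| = 1.
Proof. exact: set_mem (expi_subproof x). Qed.

Lemma norm_exp2pii (z : CC R) :
  `|exp2pii z| = Creal (expR (- (2 * pi * complex.Im z))).
Proof.
rewrite /exp2pii normrM norm_expi mulr1 -[(_%:C)%C]/(Creal _) norm_Creal.
by rewrite ger0_norm // expR_ge0.
Qed.

Lemma exp2pii_neq0 (z : CC R) : exp2pii z != 0.
Proof.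
rewrite -normr_eq0 norm_exp2pii; apply: lt0r_neq0.
by rewrite Creal_gt0 expR_gt0.
Qed.

Lemma normalized_exp2pii (z : CC R) :
  exp2pii z / `|exp2pii z| = expi (2 * pi * complex.Re z).
Proof.
rewrite norm_exp2pii /exp2pii -[(_%:C)%C]/(Creal _) mulrAC divff ?mul1r //.
by apply: lt0r_neq0; rewrite Creal_gt0 expR_gt0.
Qed.

Lemma norm_circle (a : circle R) : `|val a| = 1.
Proof. exact: set_valP a. Qed.

Lemma circle_neq0 (a : circle R) : val a != 0.
Proof. by rewrite -normr_eq0 norm_circle oner_neq0. Qed.

Fact phase_subproof (z : CC R) :
  (if z == 0 then 1 else z / `|z|) \in [set z : CC R | `|z| = 1].
Proof.
apply/mem_set => /=; case: eqVneq => [_|z0]; first exact: normr1.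
by rewrite normrM normfV normr_id divff ?normr_eq0.
Qed.

(** The value at 0 makes the phase total; it is arbitrary. *)
Definition phase (z : CC R) : circle R := in_sub (phase_subproof z).

Lemma val_phase z : z != 0 -> val (phase z) = z / `|z|.
Proof. by move=> z0; rewrite /= (negbTE z0). Qed.

Lemma continuous_phase z : z != 0 -> {for z, continuous phase}.
Proof.
move=> z0; apply: continuous_to_val.
apply: (@near_continuous _ _ (fun y : CC R => y / `|y|)).
  near=> y; rewrite val_phase //; near: y.
  exact: (near_neq0 (f := id)).
apply: continuous_atM; first exact: cvg_id.
by apply: continuous_atV; [rewrite normr_eq0 | exact: norm_continuous].
Unshelve. all: by end_near. Qed.

Lemma phaseM z w : z != 0 -> w != 0 ->
  phase (z * w) = circleM (phase z) (phase w).
Proof.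
move=> z0 w0; apply: val_inj.
by rewrite /= mulf_eq0 (negbTE z0) (negbTE w0) /= normrM invfM mulrACA.
Qed.

Lemma phase_circle (a : circle R) : phase (val a) = a.
Proof.
by apply: val_inj; rewrite val_phase ?circle_neq0 // norm_circle divr1.
Qed.

Lemma circleMC (a b : circle R) : circleM a b = circleM b a.
Proof. by apply: val_inj => /=; exact: mulrC. Qed.

Lemma circleMA (a b c : circle R) :
  circleM a (circleM b c) = circleM (circleM a b) c.
Proof. by apply: val_inj => /=; exact: mulrA. Qed.

Lemma circleMI (a b c : circle R) : circleM a b = circleM a c -> b = c.
Proof.
by move=> /(congr1 val) /= /(mulfI (circle_neq0 a)) bc; exact: val_inj.
Qed.

Lemma continuous_circleM :
  continuous (fun ab : circle R * circle R => circleM ab.1 ab.2).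
Proof.
move=> [a b]; apply: continuous_to_val; apply: continuous_atM.
  apply: (@continuous_at_comp _ _ _ fst (fun a : circle R => val a)).
    exact: continuous_at_fst.
  exact: continuous_val.
apply: (@continuous_at_comp _ _ _ snd (fun a : circle R => val a)).
  exact: continuous_at_snd.
exact: continuous_val.
Qed.

Lemma continuous_circleV : continuous (@circleV R).
Proof.
move=> a; apply: continuous_to_val; apply: continuous_atV; first exact: circle_neq0.
exact: continuous_val.
Qed.

End ComplexNumbers.

(** * Local trivialisations *)

Section CircleTrivialisation.
Variables (R : realType) (B : topologicalType).

(** The section is defined over the subspace U rather than over B: the total
    space may be empty outside U, and then no default value exists. Injectivity of
    the phase on the fibres replaces one of the two inverse laws. *)
Record circle_triv (P : circle_space R B) (U : set B) := CircleTriv {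
  ct_open : open U;
  ct_phase : P -> circle R;
  ct_sec : (U * circle R)%type -> P;
  ct_proj_cont : forall p, U (cproj p) -> {for p, continuous (@cproj _ _ P)};
  ct_phase_cont : forall p, U (cproj p) -> {for p, continuous ct_phase};
  ct_sec_cont : continuous ct_sec;
  ct_proj_sec : forall x, cproj (ct_sec x) = val x.1;
  ct_phase_sec : forall x, ct_phase (ct_sec x) = x.2;
  ct_inj : forall p q, U (cproj p) -> cproj p = cproj q ->
    ct_phase p = ct_phase q -> p = q;
  ct_phase_act : forall a p, U (cproj p) ->
    ct_phase (cact a p) = circleM a (ct_phase p)
}.

(** Linearity is asked of the coordinate only; by injectivity on the fibres it
    passes to the section. *)
Record line_triv (E : vector_family R B) (U : set B) := LineTriv {
  lt_open : open U;
  lt_coord : E -> CC R;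
  lt_vec : (U * CC R)%type -> E;
  lt_proj_cont : forall e, U (vproj e) -> {for e, continuous (@vproj _ _ E)};
  lt_coord_cont : forall e, U (vproj e) -> {for e, continuous lt_coord};
  lt_vec_cont : continuous lt_vec;
  lt_proj_vec : forall x, vproj (lt_vec x) = val x.1;
  lt_coord_vec : forall x, lt_coord (lt_vec x) = x.2;
  lt_inj : forall e e', U (vproj e) -> vproj e = vproj e' ->
    lt_coord e = lt_coord e' -> e = e';
  lt_coord_add : forall e e', U (vproj e) -> vproj e = vproj e' ->
    lt_coord (vadd e e') = lt_coord e + lt_coord e';
  lt_coord_scale : forall a e, U (vproj e) ->
    lt_coord (vscale a e) = a * lt_coord e
}.

(** In a trivialisation the action is multiplication in the circle. *)
Lemma circle_triv_act_cont (P : circle_space R B) (U : set B)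
    (tau : circle_triv P U) (a : circle R) (p : P) : U (cproj p) ->
  {for (a, p), continuous (fun x : circle R * P => cact x.1 x.2)}.
Proof.
move=> Up; have pc := ct_proj_cont tau Up.
pose b0 : U := in_sub (mem_set Up).
have c2 : {for (a, p), continuous (@snd (circle R) P)}.
  exact: continuous_at_snd.
have cp : {for (a, p), continuous (fun x : circle R * P => cproj x.2)}.
  exact: (continuous_at_comp c2).
apply: (@near_continuous _ _ (fun x : circle R * P =>
  ct_sec tau (insubd b0 (cproj x.2), circleM x.1 (ct_phase tau x.2)))).
  near=> x; have Ux : U (cproj x.2).
    near: x; apply: cp; apply: open_nbhs_nbhs; split=> //; exact: ct_open tau.
  apply: (ct_inj (c := tau)); rewrite ?ct_proj_sec ?ct_phase_sec /= ?cproj_act.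
  - by rewrite val_insubd mem_set.
  - by rewrite val_insubd mem_set.
  - by rewrite ct_phase_act.
apply: (@continuous_at_comp _ _ _ (fun x : circle R * P =>
  ((insubd b0 (cproj x.2) : U), circleM x.1 (ct_phase tau x.2))) (ct_sec tau));
  last exact: ct_sec_cont.
apply: continuous_at_pair.
  apply: (continuous_at_comp cp); apply: continuous_insubd => //.
  exact: ct_open tau.
apply: (@continuous_at_comp _ _ _ (fun x : circle R * P =>
  (x.1, ct_phase tau x.2)) (fun ab => circleM ab.1 ab.2));
  last exact: continuous_circleM.
apply: continuous_at_pair; first exact: continuous_at_fst.
apply: (@continuous_at_comp _ _ _ (@snd (circle R) P) (ct_phase tau)) => //.
exact: ct_phase_cont.
Unshelve. all: by end_near. Qed.

End CircleTrivialisation.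

(** * The line bundle associated with a circle bundle *)

Section AssociatedLine.
Variables (R : realType) (B : topologicalType) (P : circle_space R B).
Local Notation L := (associated_line P).

(** The relation defining the associated bundle, with its choice of a
    representative removed. *)
Lemma assoc_classP (x y : (P * CC R)%type) :
  assoc_class x = assoc_class y <->
  exists a : circle R, y.1 = cact a x.1 /\ x.2 = val a * y.2.
Proof.
rewrite /assoc_class; split=> [/eqmodP/asboolP //|h].
by apply/eqmodP/asboolP.
Qed.

Lemma assoc_classK (e : L) : assoc_class (assoc_repr e) = e.
Proof. exact: reprK. Qed.

Lemma vproj_assoc_class x : vproj (assoc_class x : L) = cproj x.1.
Proof. exact: assoc_proj_class. Qed.

Lemma vscale_assoc_class a p z :
  vscale a (assoc_class (p, z) : L) = assoc_class (p, a * z).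
Proof.
rewrite /= /assoc_scale; case E : (assoc_repr _) => [q w].
have := assoc_classK (assoc_class (p, z)); rewrite E => /assoc_classP[b /= [-> ->]].
by apply/assoc_classP; exists b; split=> //=; rewrite mulrCA.
Qed.

Lemma continuous_assoc_class : continuous (fun x => assoc_class x : L).
Proof. exact: continuous_pi_quotient. Qed.

Lemma assoc_class_surj (e : L) : exists p z, e = assoc_class (p, z).
Proof.
exists (assoc_repr e).1, (assoc_repr e).2.
by rewrite -surjective_pairing assoc_classK.
Qed.

Section Trivialisation.
Variables (U : set B) (tau : circle_triv P U).

(** The function (p, z) |-> phase(p) z is invariant under
    (a p, z) ~ (p, a z), hence it is a coordinate on the associated line. *)
Definition assoc_coord (e : L) : CC R :=
  val (ct_phase tau (assoc_repr e).1) * (assoc_repr e).2.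

Definition assoc_vec (x : U * CC R) : L :=
  assoc_class (ct_sec tau (x.1, circle1 R), x.2).

Lemma assoc_coord_class p z : U (cproj p) ->
  assoc_coord (assoc_class (p, z)) = val (ct_phase tau p) * z.
Proof.
move=> Up; rewrite /assoc_coord.
have /assoc_classP[a /= [pe ->]] := assoc_classK (assoc_class (p, z)).
set q := assoc_repr _ in pe *; have Uq : U (cproj q.1).
  by rewrite -(cproj_act a) -pe.
by rewrite pe ct_phase_act //= mulrA (mulrC (val a)).
Qed.

Lemma assoc_coord_inj (e e' : L) : U (vproj e) -> vproj e = vproj e' ->
  assoc_coord e = assoc_coord e' -> e = e'.
Proof.
have [p [z ->]] := assoc_class_surj e; have [q [w ->]] := assoc_class_surj e'.
rewrite !vproj_assoc_class /= => Up pq.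
rewrite !assoc_coord_class -?pq // => h.
pose a := circleM (ct_phase tau q) (circleV (ct_phase tau p)).
apply/assoc_classP; exists a; split=> /=.
  apply: (ct_inj (c := tau)); rewrite ?cproj_act -?pq //.
  rewrite ct_phase_act // /a -circleMA circleVM circleMC.
  by apply: val_inj; rewrite /= mul1r.
apply: (mulfI (circle_neq0 (ct_phase tau p))).
by rewrite h mulrA (mulrC _ (val _ / val _)) divfK ?circle_neq0.
Qed.

Lemma open_assoc_over : open [set e : L | U (vproj e)].
Proof.
apply: open_quotient.
have -> : [set x : P * CC R | [set e : L | U (vproj e)] (\pi_{eq_quot _} x)%qT] =
    fst @^-1` (@cproj _ _ P @^-1` U).
  rewrite predeqE => x.
  by rewrite -[X in X <-> _]/(U (vproj (assoc_class x : L))) vproj_assoc_class.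
apply: open_preimage_at => [|x _]; last exact: continuous_at_fst.
by apply: open_preimage_at (ct_open tau) _; exact: ct_proj_cont tau.
Qed.

Lemma assoc_continuous_at (S : topologicalType) (f : L -> S) :
  (forall x : P * CC R, U (cproj x.1) ->
     {for x, continuous (fun y : P * CC R => f (assoc_class y))}) ->
  forall e, U (vproj e) -> {for e, continuous f}.
Proof.
move=> cf e Ue; apply: (quotient_continuous_at open_assoc_over _ Ue) => x Ux.
by apply: cf; rewrite -vproj_assoc_class.
Qed.

Program Definition assoc_triv : line_triv L U :=
  @LineTriv _ _ L U (ct_open tau) assoc_coord assoc_vec
    _ _ _ _ _ assoc_coord_inj _ _.
Next Obligation.
move=> e Ue; apply: (assoc_continuous_at _ Ue) => x Up.
apply: (@continuous_at_eq _ _ (fun y : P * CC R => cproj y.1)) => [y|].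
  by rewrite vproj_assoc_class.
apply: (continuous_at_comp (@continuous_at_fst _ _ x)).
exact: ct_proj_cont tau _ Up.
Qed.
Next Obligation.
move=> e Ue; apply: (assoc_continuous_at _ Ue) => x Up.
apply: (@continuous_at_eq_on _ _ (fun y : P * CC R => val (ct_phase tau y.1) * y.2)
  _ _ ((fun y : P * CC R => cproj y.1) @^-1` U)) => [|[p z] Uy|].
- apply: (nbhs_preimage_open _ (ct_open tau)) => //.
  apply: (continuous_at_comp (@continuous_at_fst _ _ x)).
  exact: ct_proj_cont tau _ Up.
- by rewrite assoc_coord_class.
apply: continuous_atM; last exact: continuous_at_snd.
apply: (@continuous_at_comp _ _ _ (fun y : P * CC R => ct_phase tau y.1)
  (fun a : circle R => val a)); last exact: continuous_val.
apply: (continuous_at_comp (@continuous_at_fst _ _ x)).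
exact: ct_phase_cont tau _ Up.
Qed.
Next Obligation.
move=> x; apply: (@continuous_at_comp _ _ _ (fun x : U * CC R =>
  (ct_sec tau (x.1, circle1 R), x.2))); last exact: continuous_assoc_class.
apply: continuous_at_pair; last exact: continuous_at_snd.
apply: (@continuous_at_comp _ _ _ (fun x : U * CC R => (x.1, circle1 R))
  (ct_sec tau)).
  by apply: continuous_at_pair; [exact: continuous_at_fst | exact: cst_continuous].
exact: ct_sec_cont.
Qed.
Next Obligation. by move=> x; rewrite [LHS]vproj_assoc_class ct_proj_sec. Qed.
Next Obligation.
move=> x; rewrite assoc_coord_class ?ct_proj_sec ?ct_phase_sec /= ?mul1r //.
exact: set_valP.
Qed.
Next Obligation.
move=> e e' Ue ee'; rewrite /= /assoc_add; case E : (assoc_repr e) => [p z].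
have ep : e = assoc_class (p, z) by rewrite -E assoc_classK.
have Up : U (cproj p) by move: Ue; rewrite ep vproj_assoc_class.
rewrite assoc_coord_class // mulrDr ep assoc_coord_class //; congr (_ + _).
case: xgetP => [z' _ <-|]; first by rewrite assoc_coord_class.
move=> /(_ ((val (ct_phase tau p))^-1 * assoc_coord e')) [].
apply: assoc_coord_inj; rewrite ?vproj_assoc_class //=.
  by rewrite -[RHS]ee' ep [RHS]vproj_assoc_class.
by rewrite assoc_coord_class // mulVKf // circle_neq0.
Qed.
Next Obligation.
move=> a e; have [p [z ->]] := assoc_class_surj e.
rewrite vproj_assoc_class => Up.
by rewrite vscale_assoc_class !assoc_coord_class // mulrCA.
Qed.

End Trivialisation.

End AssociatedLine.

(** * Equality of the Chern classes *)

Section ChernClass.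
Variables (R : realType) (B : topologicalType) (P : circle_space R B).
Local Notation L := (associated_line P).

Hypothesis actC : continuous (fun x : circle R * P => cact x.1 x.2).

(** A section s of P gives the nowhere vanishing section [s, 1], with the same
    transition functions, so that the real logarithms l can be kept. *)
Lemma circle_line_cocycle m : circle_cocycle P m -> line_cocycle L m.
Proof.
move=> [s [l [hs hl hm]]].
exists (fun i p => assoc_class (s i p, 1)), (fun i j p => Creal (l i j p)).
split=> [i p mip|i j p mip mjp|i j k p mi mj mk].
- have [sp sc] := hs i p mip; split.
  + by rewrite vproj_assoc_class.
  + rewrite vscale_assoc_class mul0r => /assoc_classP[a /= [_ /eqP]].
    by rewrite mulr0 oner_eq0.
  + apply: (@continuous_at_comp _ _ _ (fun p => (s i p, 1 : CC R))
      (fun x => assoc_class x : L)).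
      by apply: continuous_at_pair; [exact: sc | exact: cst_continuous].
    exact: continuous_assoc_class.
- have [-> lc] := hl i j p mip mjp; split.
    rewrite vscale_assoc_class exp2pii_Creal.
    apply/assoc_classP; exists (circleV (circle_expi (2 * pi * l i j p))).
    rewrite /= -cactM circleVM cact1; split=> //.
    by rewrite mulr1 mulVf // -normr_eq0 norm_expi oner_neq0.
  by apply: (continuous_at_comp lc); exact: continuous_Creal.
- have := hm i j k p mi mj mk => /(congr1 (@Creal R)).
  by rewrite /Creal rmorphD rmorphB rmorph_int.
Qed.

(** The retraction [p, z] |-> (z / |z|) p of the nonzero vectors of L onto P,
    the circle bundle of its unit vectors. *)
Definition unit_vector (e : L) : P :=
  cact (phase (assoc_repr e).2) (assoc_repr e).1.

Lemma unit_vector_class p z : z != 0 ->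
  unit_vector (assoc_class (p, z)) = cact (phase z) p.
Proof.
move=> z0; rewrite /unit_vector.
have /assoc_classP[a /= [pe ze]] := assoc_classK (assoc_class (p, z)).
set q := assoc_repr _ in pe ze *; rewrite pe -cactM ze phaseM ?circle_neq0 //.
  by rewrite phase_circle circleMC.
Qed.

Lemma nonzero_assoc_class p z :
  (assoc_class (p, z) <> vscale 0 (assoc_class (p, z) : L)) <-> z != 0.
Proof.
rewrite vscale_assoc_class mul0r; split=> [h|/eqP z0 /assoc_classP[a /= [_]]].
  by apply/eqP => z0; apply: h; rewrite z0.
by rewrite mulr0.
Qed.

Lemma cproj_unit_vector e : cproj (unit_vector e) = vproj e.
Proof. exact: cproj_act. Qed.

Lemma unit_vector_scale a e : a != 0 -> e <> vscale 0 e ->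
  unit_vector (vscale a e) = cact (phase a) (unit_vector e).
Proof.
have [p [z ->]] := assoc_class_surj e => a0 /nonzero_assoc_class z0.
rewrite vscale_assoc_class !unit_vector_class ?mulf_neq0 //.
by rewrite phaseM // cactM.
Qed.

Lemma unit_vector_cont e : e <> vscale 0 e -> {for e, continuous unit_vector}.
Proof.
have oNZ : open [set z : CC R | z != 0].
  by rewrite openE => z z0; exact: (near_neq0 (f := id)).
have oU : open [set e : L | e <> vscale 0 e].
  apply: open_quotient.
  have -> : [set x : P * CC R | [set e : L | e <> vscale 0 e] (\pi_{eq_quot _} x)%qT]
      = snd @^-1` [set z | z != 0].
    by rewrite predeqE => -[p z]; exact: nonzero_assoc_class.
  by apply: open_preimage_at; [exact: oNZ | move=> x _; exact: continuous_at_snd].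
apply: (quotient_continuous_at oU) => -[p z] /nonzero_assoc_class z0.
apply: (@continuous_at_eq_on _ _ (fun x : P * CC R => cact (phase x.2) x.1)
  _ _ (snd @^-1` [set z | z != 0])) => [|[q w] w0|].
- apply: nbhs_preimage_open; [exact: continuous_at_snd | exact: oNZ | exact: z0].
- by rewrite -[RHS]/(unit_vector (assoc_class (q, w))) unit_vector_class.
apply: (@continuous_at_comp _ _ _ (fun x : P * CC R => (phase x.2, x.1))
  (fun x => cact x.1 x.2)); last exact: actC.
apply: continuous_at_pair; last exact: continuous_at_fst.
apply: (@continuous_at_comp _ _ _ snd (@phase R)); first exact: continuous_at_snd.
exact: continuous_phase.
Qed.

(** Normalising the sections of L replaces the transition function
    exp(2 pi i l) by its phase exp(2 pi i Re l). Since the cocycle is an integer, it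
    is also the coboundary of the real parts. *)
Lemma line_circle_cocycle m : line_cocycle L m -> circle_cocycle P m.
Proof.
move=> [s [l [hs hl hm]]].
exists (fun i p => unit_vector (s i p)), (fun i j p => complex.Re (l i j p)).
split=> [i p mip|i j p mip mjp|i j k p mi mj mk].
- have [sp s0 sc] := hs i p mip; split; first by rewrite cproj_unit_vector.
  by apply: (continuous_at_comp sc); exact: unit_vector_cont.
- have [-> lc] := hl i j p mip mjp; split.
    have [_ s0 _] := hs i p mip; rewrite unit_vector_scale ?exp2pii_neq0 //.
    congr (cact _ _); apply: val_inj.
    by rewrite val_phase ?exp2pii_neq0 // normalized_exp2pii.
  by apply: (continuous_at_comp lc); exact: continuous_Re.
- have h := congr1 (fun z : CC R => complex.Re z) (hm i j k p mi mj mk).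
  rewrite -ReB -ReD -h -[_%:~R in RHS](rmorph_int (real_complex R)).
  by [].
Qed.

(** A cocycle m represents the Chern class of P if and only if it represents
    that of L, so that both classes are selected from the same set. *)
Lemma c1_associated_line : c1_circle P = c1_line L.
Proof.
rewrite /c1_circle /c1_line; congr xget; apply/seteqP; split=> x /= [m h ->];
  exists m => //; [exact: circle_line_cocycle | exact: line_circle_cocycle].
Qed.

End ChernClass.

(** * Isomorphisms of line bundles from local data *)

Section LineMaps.
Variables (R : realType) (B : topologicalType) (I : Type) (U : I -> set B).
Hypothesis cover : forall b, exists i, U i b.

Section Map.
Variables (E F : vector_family R B).
Variables (tE : forall i, line_triv E (U i)) (tF : forall i, line_triv F (U i)).
Variable c : forall i, U i -> CC R.
Hypothesis c_cont : forall i, continuous (@c i).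
Hypothesis c_compat : forall i j (x : U i) (y : U j), val x = val y ->
  forall e e', vproj e = val x -> vproj e' = val x ->
    lt_coord (tF i) e' = c x * lt_coord (tE i) e ->
    lt_coord (tF j) e' = c y * lt_coord (tE j) e.

(** Over each U_i the map multiplies the coordinate by c_i; compatibility makes
    these local maps agree, so that a global map is obtained by choosing for each
    point of the base some U_i containing it. *)
Lemma line_map_exists : exists f : E -> F,
  [/\ continuous f, forall e, vproj (f e) = vproj e
    & forall i (x : U i) e, vproj e = val x ->
        lt_coord (tF i) (f e) = c x * lt_coord (tE i) e].
Proof.
have [ch hch] := choice cover.
pose pt (b : B) : U (ch b) := in_sub (mem_set (hch b)).
pose f (e : E) : F := lt_vec (tF (ch (vproj e)))
  (pt (vproj e), c (pt (vproj e)) * lt_coord (tE (ch (vproj e))) e).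
have fproj e : vproj (f e) = vproj e by rewrite lt_proj_vec.
have fcoord i (x : U i) e : vproj e = val x ->
    lt_coord (tF i) (f e) = c x * lt_coord (tE i) e.
  move=> ex; apply: (c_compat (x := pt (vproj e))) => //.
  by rewrite lt_coord_vec.
exists f; split=> // e.
set i := ch (vproj e); set x := pt (vproj e).
have Ue : U i (vproj e) by exact: hch.
have oU := lt_open (tE i); have pc := lt_proj_cont (tE i) Ue.
have ic : {for e, continuous (fun e' : E => insubd x (vproj e') : U i)}.
  by apply: (continuous_at_comp pc); exact: continuous_insubd.
apply: (@continuous_at_eq_on _ _ (fun e' : E => lt_vec (tF i)
  (insubd x (vproj e'), c (insubd x (vproj e') : U i) * lt_coord (tE i) e'))
  _ _ (@vproj _ _ E @^-1` U i)).
- by apply: nbhs_preimage_open; [exact: pc | exact: oU | exact: Ue].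
- move=> e' Ue'; have ve' : val (insubd x (vproj e')) = vproj e'.
    by rewrite val_insubd mem_set.
  apply: (lt_inj (l := tF i)); rewrite ?lt_proj_vec ?fproj ?ve' //.
  by rewrite lt_coord_vec /= (fcoord i (insubd x (vproj e'))).
apply: (@continuous_at_comp _ _ _ (fun e' : E =>
  ((insubd x (vproj e') : U i),
   c (insubd x (vproj e') : U i) * lt_coord (tE i) e')));
  last exact: lt_vec_cont.
apply: continuous_at_pair; first exact: ic.
apply: continuous_atM; last exact: lt_coord_cont.
by apply: (continuous_at_comp ic); exact: c_cont.
Qed.

End Map.

Section Iso.
Variables (E F : vector_family R B).
Variables (tE : forall i, line_triv E (U i)) (tF : forall i, line_triv F (U i)).

Lemma line_iso (c : forall i, U i -> CC R) :
  (forall i x, @c i x != 0) -> (forall i, continuous (@c i)) ->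
  (forall i j (x : U i) (y : U j), val x = val y ->
    forall e e', vproj e = val x -> vproj e' = val x ->
    lt_coord (tF i) e' = c i x * lt_coord (tE i) e ->
    lt_coord (tF j) e' = c j y * lt_coord (tE j) e) ->
  vector_family_iso E F.
Proof.
move=> c0 cc compat.
have [f [fc fp fE]] := line_map_exists cc compat.
have [||g [gc gp gE]] :=
    @line_map_exists F E tF tE (fun i x => (c i x)^-1).
- by move=> i x; apply: continuous_atV; [exact: c0 | exact: cc].
- move=> i j x y xy e e' ex e'x h.
  have := compat i j x y xy e' e e'x ex.
  by rewrite h mulVKf // => ->; rewrite ?mulKf.
have ptP i b : U i b -> exists x : U i, b = val x.
  by move=> Ub; exists (in_sub (mem_set Ub)).
exists f, g; split; split=> //.
- move=> e; have [i Ue] := cover (vproj e); have [x ex] := ptP _ _ Ue.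
  apply: (lt_inj (l := tE i)); rewrite ?gp ?fp //.
  by rewrite (gE i x) ?fp // (fE i x) // mulKf.
- move=> e; have [i Ue] := cover (vproj e); have [x ex] := ptP _ _ Ue.
  apply: (lt_inj (l := tF i)); rewrite ?fp ?gp //.
  by rewrite (fE i x) ?gp // (gE i x) // mulVKf.
- move=> e e' ee'; have [i Ue] := cover (vproj e); have [x ex] := ptP _ _ Ue.
  have Ue' : U i (vproj e') by rewrite -ee'.
  apply: (lt_inj (l := tF i)); rewrite ?fp ?vproj_add ?fp //.
  rewrite lt_coord_add ?fp // !(fE i x) ?vproj_add -?ee' //.
  by rewrite lt_coord_add // mulrDr.
- move=> a e; have [i Ue] := cover (vproj e); have [x ex] := ptP _ _ Ue.
  apply: (lt_inj (l := tF i)); rewrite ?fp ?vproj_scale ?fp //.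
  rewrite lt_coord_scale ?fp // !(fE i x) ?vproj_scale //.
  by rewrite lt_coord_scale // mulrCA.
Qed.

(** In a norm n on F, the vector of coordinate 1 over U_i has a length n_i, and
    n_j = n_i / |a| when the coordinates of F change by a. Dividing the coordinates
    by these lengths therefore corrects a into a / |a|. *)
Lemma line_iso_of_norm (n : F -> CC R) :
  continuous n -> (forall a e, n (vscale a e) = `|a| * n e) ->
  (forall i e, U i (vproj e) -> lt_coord (tF i) e != 0 -> n e != 0) ->
  (forall i j b, U i b -> U j b -> exists a : CC R, [/\ a != 0,
     forall e, vproj e = b -> lt_coord (tE j) e = a / `|a| * lt_coord (tE i) e
   & forall e, vproj e = b -> lt_coord (tF j) e = a * lt_coord (tF i) e]) ->
  vector_family_iso E F.
Proof.
move=> nc nZ n0 trans.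
have Uv i (x : U i) : U i (val x) by exact: set_valP.
have nv0 i (x : U i) : n (lt_vec (tF i) (x, 1)) != 0.
  by apply: (n0 i); rewrite ?lt_proj_vec // lt_coord_vec oner_neq0.
apply: (@line_iso (fun i x => (n (lt_vec (tF i) (x, 1)))^-1)).
- by move=> i x; rewrite invr_eq0.
- move=> i x; apply: continuous_atV; first exact: nv0.
  apply: (@continuous_at_comp _ _ _ (fun x : U i => lt_vec (tF i) (x, 1)) n);
    last exact: nc.
  apply: (@continuous_at_comp _ _ _ (fun x : U i => (x, 1 : CC R)));
    last exact: lt_vec_cont.
  by apply: continuous_at_pair; [exact: cvg_id | exact: cst_continuous].
move=> i j x y xy e e' ex e'x h.
have Ujx : U j (val x) by rewrite xy.
have [a [a0 aE aF]] := trans i j (val x) (Uv i x) Ujx.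
rewrite aF // aE // h.
have -> : lt_vec (tF j) (y, 1) = vscale a^-1 (lt_vec (tF i) (x, 1)).
  apply: (lt_inj (l := tF j)); rewrite ?lt_proj_vec ?vproj_scale ?lt_proj_vec //.
  rewrite lt_coord_scale ?lt_proj_vec // lt_coord_vec aF ?lt_proj_vec //.
  by rewrite lt_coord_vec mulr1 mulVf.
rewrite nZ normfV invfM invrK; set N := n _.
have na0 : `|a| != 0 by rewrite normr_eq0.
by rewrite [RHS]mulrACA [`|a| * _]mulrCA divff // mulr1.
Qed.

End Iso.

End LineMaps.

(** * Norms on line bundles over compact spaces *)

Section Norm.
Variables (R : realType) (B : topologicalType) (I : Type) (U : I -> set B).
Variables (F : vector_family R B) (tF : forall i, line_triv F (U i)).
Hypothesis cover : forall b, exists i, U i b.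
Hypothesis (cB : compact [set: B]) (hB : hausdorff_space B).

(** Compact Hausdorff spaces are normal, and Urysohn's lemma applies. *)
Lemma bump_exists (V : set B) b : open V -> V b -> exists2 chi : B -> R,
  continuous chi /\ chi b = 1 & forall y, ~ V y -> chi y = 0.
Proof.
move=> oV Vb; have /(@normal_separatorP R) nB := compact_normal hB cB.
have cb : closed [set b].
  by apply: accessible_closed_set1; exact: hausdorff_accessible.
have dis : ~` V `&` [set b] = set0.
  by apply/seteqP; split=> // y [nVy yb]; apply: nVy; rewrite yb.
have /(@uniform_separatorP _ R)[f [fc _ f0 f1]] := nB _ _ (open_closedC oV) cb dis.
exists f; last by move=> y nVy; apply: f0; exists y.
by split=> //; apply: f1; exists b.
Qed.

Lemma lt_coord_neq0 i j e : U i (vproj e) -> U j (vproj e) ->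
  lt_coord (tF i) e != 0 -> lt_coord (tF j) e != 0.
Proof.
move=> Ui Uj; apply: contraNneq => e0.
have -> : e = vscale 0 e.
  by apply: (lt_inj (l := tF j)); rewrite ?vproj_scale // lt_coord_scale // e0 mulr0.
by rewrite lt_coord_scale ?mul0r.
Qed.

Lemma compact_finite_subcover (P : B -> set B) :
  (forall b, open (P b)) -> (forall b, P b b) ->
  exists D : seq B, forall y, exists2 b, b \in D & P b y.
Proof.
move=> oP Pb; have [[b0 _]|nB] := pselect (exists b : B, True); last first.
  by exists [::] => y; case: nB; exists y.
pose pB : ptopologicalType := HB.pack B (isPointed.Build B b0).
have : @compact pB [set: pB] by [].
rewrite compact_cover => /(_ B setT P) [|y _|D _ hD].
- by move=> b _; exact: oP.
- by exists y.
by exists (finmap.enum_fset D) => y; have [b bD Py] := hD y Logic.I; exists b.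
Qed.

(** The norm is the sum, over a finite cover, of the absolute values of the
    coordinates, each multiplied by a bump function supported where the coordinate
    is defined. *)
Lemma norm_exists : exists n : F -> CC R,
  [/\ continuous n, forall a e, n (vscale a e) = `|a| * n e
    & forall i e, U i (vproj e) -> lt_coord (tF i) e != 0 -> n e != 0].
Proof.
have [ch hch] := choice cover.
have /choice[chi hchi] b : exists chi : B -> R, [/\ continuous chi, chi b = 1
    & forall y, ~ U (ch b) y -> chi y = 0].
  have [chi [? ?] ?] := bump_exists (lt_open (tF (ch b))) (hch b).
  by exists chi.
(* Twice the positive part of chi - 1/2: it vanishes near every point where chi
   does, and not only at that point. *)
pose bump b y : R := (chi b y - 2^-1) + `|chi b y - 2^-1|.
have bump_cont b : continuous (bump b).
  move=> y; have [cc _ _] := hchi b.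
  have cu : {for y, continuous (fun y => chi b y - 2^-1)}.
    by apply: continuous_atD; [exact: cc | exact: cst_continuous].
  apply: (@continuous_atD R _ (fun y => chi b y - 2^-1)
    (fun y => `|chi b y - 2^-1|)); first exact: cu.
  by apply: (continuous_at_comp cu); exact: norm_continuous.
have bump0 b y : ~ U (ch b) y -> \forall z \near y, bump b z = 0.
  have [cc _ /[apply] cy] := hchi b.
  have : \forall z \near y, chi b z < 2^-1.
    apply: (@nbhs_preimage_open _ _ (chi b) y [set r | r < 2^-1]).
    - exact: cc.
    - exact: open_lt.
    - by rewrite /= cy invr_gt0.
  apply: filterS => z hz.
  by rewrite /bump ler0_norm ?subrr // subr_le0 ltW.
have bump_ge0 b y : 0 <= bump b y by rewrite -lerBlDl sub0r -normrN ler_norm.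
have [D hD] : exists D : seq B, forall y, exists2 b, b \in D & 0 < bump b y.
  apply: compact_finite_subcover => // b.
    apply: (@open_preimage_at _ _ (bump b) [set r | 0 < r]); first exact: open_gt.
    by move=> x _; exact: bump_cont.
  have [_ c1 _] := hchi b; rewrite /bump c1.
  by rewrite addr_gt0 // ?normr_gt0 ?gt_eqF // subr_gt0 invf_lt1 ?ltr1n.
pose term b (e : F) : CC R := Creal (bump b (vproj e)) * `|lt_coord (tF (ch b)) e|.
have term_ge0 b e : 0 <= term b e.
  by rewrite /term mulr_ge0 // [0]/(Creal 0) Creal_le.
have bump_nU b y : ~ U (ch b) y -> bump b y = 0.
  by move=> /bump0 /nbhs_singleton.
exists (fun e => \sum_(b <- D) term b e); split=> [e|a e|i e Ue e0].
- apply: continuous_at_sum => b.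
  have [i Ue] := cover (vproj e); have pc := lt_proj_cont (tF i) Ue.
  have [Ube|nUbe] := pselect (U (ch b) (vproj e)).
    apply: continuous_atM.
      apply: (@continuous_at_comp _ _ _ (fun e => bump b (vproj e)) (@Creal R));
        last exact: continuous_Creal.
      by apply: (continuous_at_comp pc); exact: bump_cont.
    apply: (@continuous_at_comp _ _ _ (lt_coord (tF (ch b))) (@Num.norm _ (CC R)));
      last exact: norm_continuous.
    exact: lt_coord_cont.
  apply: (@continuous_at_eq_on _ _ (fun=> 0) _ _ _ (pc _ (bump0 b _ nUbe))).
    by move=> e' /= he'; rewrite /term he' mul0r.
  exact: cst_continuous.
- rewrite mulr_sumr; apply: eq_bigr => b _.
  rewrite /term vproj_scale; have [Ue|nUe] := pselect (U (ch b) (vproj e)).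
    by rewrite lt_coord_scale // normrM mulrCA.
  by rewrite bump_nU // !mul0r mulr0.
- have [b bD b0] := hD (vproj e).
  apply/eqP => /eqP; rewrite psumr_eq0 // => /allP/(_ b bD) /= /eqP.
  have Ub : U (ch b) (vproj e).
    by apply: contrapT => /bump_nU b00; move: b0; rewrite b00 ltxx.
  apply/eqP; rewrite mulf_neq0 ?normr_eq0 ?(lt_coord_neq0 Ue Ub) //.
  by apply: lt0r_neq0; rewrite Creal_gt0.
Qed.

End Norm.

(** * Differential calculus *)

Section Calculus.
Variable K : numFieldType.
Implicit Types U V W : normedModType K.

Lemma differentiable_near V W (f g : V -> W) x :
  (\forall y \near x, f y = g y) -> differentiable f x -> differentiable g x.
Proof.
move=> fg df; have fgx : f x = g x := nbhs_singleton fg.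
have gE : g \o shift x = cst (g x) + 'd f x +o_ 0 id.
  apply/eqaddoP => e e0.
  have /eqaddoP/(_ e e0) := diff_locally df.
  have fg0 : \forall h \near (0 : V), f (h + x) = g (h + x).
    by move: fg; rewrite (near_shift 0) /=; apply: filterS => h; rewrite /= subr0.
  apply: filterS2 fg0 => h /= e1.
  by rewrite !fctE /= -e1 fgx.
have dg := diff_unique (diff_continuous df) gE.
by apply/diff_locallyP; rewrite dg; split=> //; exact: diff_continuous.
Qed.

Lemma derive_comp U V W (f : U -> V) (g : V -> W) x u :
  differentiable f x -> differentiable g (f x) ->
  'D_u (g \o f) x = 'D_('D_u f x) g (f x).
Proof.
move=> df dg; rewrite !deriveE //; last exact: differentiable_comp.
by rewrite diff_comp.
Qed.

Lemma deriveZD V W (f : V -> W) x a u v : differentiable f x ->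
  'D_(a *: u + v) f x = a *: 'D_u f x + 'D_v f x.
Proof. by move=> df; rewrite !deriveE // linearP. Qed.

Lemma derive_rowE n W (f : 'rV[K]_n -> W) x u : differentiable f x ->
  'D_u f x = \sum_i u 0 i *: 'D_(delta_mx 0 i) f x.
Proof.
move=> df; rewrite deriveE // {1}[u]row_sum_delta linear_sum.
by apply: eq_bigr => i _; rewrite linearZ deriveE.
Qed.

Lemma derive_coord V n (f : V -> 'rV[K]_n) x u j : differentiable f x ->
  'D_u (fun y => f y 0 j) x = ('D_u f x) 0 j.
Proof.
move=> df; have dc := differentiable_coord (f x) 0 j.
rewrite (derive_comp u df dc) deriveE //.
have @l : {linear 'rV[K]_n -> K}.
  by exists (fun M : 'rV[K]_n => M 0 j); do 2![eexists]; do ?[constructor];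
     rewrite ?mxE// => ? *; rewrite ?mxE//; move=> ?; rewrite !mxE.
by rewrite (_ : (fun _ => _) = l) // diff_lin //; exact: coord_continuous.
Qed.

Lemma open_iterD_coord V n (A : set V) (f : V -> 'rV[K]_n) j ds x :
  open A -> smooth_on A f -> A x ->
  Defs.iterD ds (fun y => f y 0 j) x = Defs.iterD ds f x 0 j.
Proof.
move=> oA sf; elim: ds x => //= d ds IH x Ax.
rewrite -(derive_coord _ _ (sf ds x Ax)); apply: near_eq_derive.
have xA : nbhs x A by exact: open_nbhs_nbhs.
by apply: filterS xA => y; exact: IH.
Qed.

Lemma smooth_on_coord V n (A : set V) (f : V -> 'rV[K]_n) j :
  open A -> smooth_on A f -> smooth_on A (fun y => f y 0 j).
Proof.
move=> oA sf ds x Ax.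
apply: (@differentiable_near _ _ (fun y => Defs.iterD ds f y 0 j)).
  have xA : nbhs x A by exact: open_nbhs_nbhs.
  by apply: filterS xA => y Ay; rewrite (open_iterD_coord _ _ oA sf).
apply: (@differentiable_comp _ _ _ _ (Defs.iterD ds f) (fun M : 'rV[K]_n => M 0 j)).
  exact: sf.
exact: differentiable_coord.
Qed.

(** It suffices that f be constant along the line through x in the direction
    u, and not in a neighbourhood of x. *)
Lemma derive_near_cst V W (f : V -> W) x u :
  (\forall h \near (0 : K), f (h *: u + x) = f x) -> 'D_u f x = 0.
Proof.
move=> fx; apply/lim_near_cst => //=.
near=> h; rewrite /= (_ : f (h *: u + x) = f x) ?subrr ?scaler0 //.
near: h; exact: cvg_within.
Unshelve. all: by end_near. Qed.

End Calculus.

(** * Charts and changes of charts *)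

Section Charts.
Variables (K : numFieldType) (n : nat) (X : manifold K n).

Lemma near_chart (phi : chart K n X) x (A : set X) : cdom phi x -> nbhs x A ->
  \forall w \near cmap phi x,
    [/\ cdom phi (cinv phi w), A (cinv phi w) & cmap phi (cinv phi w) = w].
Proof.
move=> px xA.
have ix : (cmap phi @` cdom phi) (cmap phi x) by exists x.
have iN := open_nbhs_nbhs (conj (@cimg_open _ _ _ phi) ix).
have cA : nbhs (cmap phi x) (cinv phi @^-1` A).
  by apply: (cinv_cont ix); rewrite cmapK.
by apply: filterS2 iN cA => w [y py <-]; rewrite /= cmapK.
Qed.

Lemma open_chart_image (phi : chart K n X) (A : set X) : open A ->
  open (cmap phi @` (A `&` cdom phi)).
Proof.
move=> oA; rewrite openE => _ [x [Ax px] <-].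
have xA : nbhs x A by exact: open_nbhs_nbhs.
by apply: filterS (near_chart px xA) => w [pw Aw <-]; exists (cinv phi w).
Qed.

Lemma near_transition T (phi psi : chart K n X) x (f : X -> T) :
  cdom phi x -> cdom psi x ->
  \forall w \near cmap psi x,
    (f \o cinv phi) (transition psi phi w) = (f \o cinv psi) w.
Proof.
move=> px qx; have xp := open_nbhs_nbhs (conj (@cdom_open _ _ _ phi) px).
by apply: filterS (near_chart qx xp) => w [_ pw _]; rewrite /= cmapK.
Qed.

Lemma transition_at (phi psi : chart K n X) x : cdom psi x ->
  transition psi phi (cmap psi x) = cmap phi x.
Proof. by move=> qx; rewrite /transition /= cmapK. Qed.

Lemma compatible_differentiable (phi psi : chart K n X) x :
  compatible phi psi -> cdom phi x -> cdom psi x ->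
  differentiable (transition phi psi) (cmap phi x).
Proof. by move=> /(_ [::]) c px qx; apply: c; exists x. Qed.

Section ChangeOfChart.
Variables (W : normedModType K) (f : X -> W) (phi psi : chart K n X) (x : X).
Hypotheses (px : cdom phi x) (qx : cdom psi x) (cqp : compatible psi phi).
Hypothesis df : differentiable (f \o cinv phi) (cmap phi x).

Lemma differentiable_chart_change : differentiable (f \o cinv psi) (cmap psi x).
Proof.
apply: (differentiable_near (near_transition f px qx)).
apply: (@differentiable_comp _ _ _ _ (transition psi phi) (f \o cinv phi)).
  exact: compatible_differentiable.
by rewrite transition_at.
Qed.

(** The chain rule for the expressions of a function in two charts. *)
Lemma derive_chart_change u : 'D_u (f \o cinv psi) (cmap psi x) =
  'D_('D_u (transition psi phi) (cmap psi x)) (f \o cinv phi) (cmap phi x).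
Proof.
rewrite -(near_eq_derive u (near_transition f px qx)).
rewrite (@derive_comp _ _ _ _ (transition psi phi)) ?transition_at //.
exact: compatible_differentiable.
Qed.

End ChangeOfChart.

End Charts.

(** * Hypersurfaces and their conormal direction *)

Definition adapted_chart (K : numFieldType) n (X : manifold K n.+1) (Q : set X)
    (psi : chart K n.+1 X) : Prop :=
  admissible psi /\ forall y, cdom psi y -> Q y <-> cmap psi y 0 0 = 0.

Section Conormal.
Variables (K : numFieldType) (n : nat) (X : manifold K n.+1) (Q : set X).
Variables (psi : chart K n.+1 X) (x : X).
Hypotheses (adapted : adapted_chart Q psi) (qx : cdom psi x) (Qx : Q x).

(** The directions other than the first one are tangent to Q, along which f is
    constant. *)
Lemma derive_adapted (f : X -> K) u :
  differentiable (f \o cinv psi) (cmap psi x) ->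
  (\forall y \near x, Q y -> f y = 0) ->
  'D_u (f \o cinv psi) (cmap psi x)
  = u 0 0 * 'D_(delta_mx 0 0) (f \o cinv psi) (cmap psi x).
Proof.
move=> df f0; rewrite derive_rowE // big_ord_recl /= [X in _ + X]big1 ?addr0 //.
move=> i _; rewrite (derive_near_cst (f := f \o cinv psi)) ?scaler0 //.
have [_ hQ] := adapted.
have fx : f x = 0 by have /nbhs_singleton := f0; apply.
pose g (h : K) : 'rV[K]_n.+1 := h *: delta_mx 0 (lift ord0 i) + cmap psi x.
have g0 : g 0 = cmap psi x by rewrite /g scale0r add0r.
have c0 : {for 0, continuous g}.
  by apply: continuousD; [exact: scalel_continuous | exact: cst_continuous].
have : nbhs (0 : K) (g @^-1`
    [set w : 'rV[K]_n.+1 | w 0 0 = 0 -> (f \o cinv psi) w = 0]).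
  apply: c0; rewrite g0; apply: filterS (near_chart qx f0) => w [pw Qw E] w0.
  by apply: Qw; apply/(hQ _ pw); rewrite E.
apply: filterS => h; rewrite /= cmapK // fx; apply.
by rewrite !mxE /= mulr0 add0r; apply/(hQ _ qx).
Qed.

Variable phi : chart K n.+1 X.
Hypotheses (aphi : atlas X phi) (px : cdom phi x).

Let cpq : compatible phi psi. Proof. exact: (adapted.1 phi aphi).2. Qed.
Let cqp : compatible psi phi. Proof. exact: (adapted.1 phi aphi).1. Qed.

(** The differential at x of the first coordinate of psi, written in the
    chart phi: it spans the conormal line of Q. *)
Definition conormal (u : 'rV[K]_n.+1) : K :=
  'D_u (transition phi psi) (cmap phi x) 0 0.

(** All functions vanishing on Q have the same differential at x up to a
    factor that does not depend on the chart phi. *)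
Lemma derive_conormal (f : X -> K) u :
  differentiable (f \o cinv phi) (cmap phi x) ->
  (\forall y \near x, Q y -> f y = 0) ->
  'D_u (f \o cinv phi) (cmap phi x)
  = conormal u * 'D_(delta_mx 0 0) (f \o cinv psi) (cmap psi x).
Proof.
move=> df f0; have dfq := differentiable_chart_change px qx cqp df.
rewrite (derive_chart_change qx px cpq dfq); exact: derive_adapted.
Qed.

Lemma derive_first_coord u :
  'D_u ((fun y => cmap psi y 0 0) \o cinv phi) (cmap phi x) = conormal u.
Proof.
by rewrite /conormal -derive_coord //; exact: compatible_differentiable.
Qed.

End Conormal.

(** Smoothness of this coordinate in the charts of the atlas is part of the
    compatibility of psi with the atlas. *)
Lemma first_coord_vanishing_germ (R : realType) n (X : manifold (CC R) n.+1)
    (Q : set X) (psi : chart (CC R) n.+1 X) x :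
  adapted_chart Q psi -> cdom psi x ->
  vanishing_germ Q x (fun y => cmap psi y 0 0).
Proof.
move=> [ad hQ] qx; exists (cdom psi); split=> //; first exact: cdom_open.
- move=> phi aphi.
  apply: (@smooth_on_coord _ _ _ _ (transition phi psi)).
    exact/open_chart_image/cdom_open.
  by rewrite setIC; exact: (ad phi aphi).2.
- by move=> y py /(hQ y py).
Qed.

(** * Coordinates of a holomorphic map *)

Section SmoothMaps.
Variables (K : numFieldType) (n m : nat) (Y : manifold K n) (X : manifold K m).
Variables (G : Y -> X) (kappa : chart K m X).
Hypotheses (sG : smooth_map_on setT G) (akappa : admissible kappa).

Section AtPoint.
Variables (phi : chart K n Y) (psi : chart K m X) (y : Y).
Hypotheses (aphi : atlas Y phi) (apsi : atlas X psi).
Hypotheses (py : cdom phi y) (qy : cdom psi (G y)) (ky : cdom kappa (G y)).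

Let F := cmap psi \o G \o cinv phi.
Let T := transition psi kappa.

Let Fy : F (cmap phi y) = cmap psi (G y).
Proof. by rewrite /F /= cmapK. Qed.

Let Gc : {for y, continuous G}. Proof. exact: sG.1. Qed.

Lemma smooth_map_chart_diff ds : differentiable (Defs.iterD ds F) (cmap phi y).
Proof.
have sF := sG.2 phi psi aphi apsi; apply: (sF ds).
by exists y => //; split => //; split.
Qed.

Lemma near_smooth_map_chart :
  \forall w \near cmap phi y, T (F w) = (cmap kappa \o G \o cinv phi) w.
Proof.
have yq : nbhs y (G @^-1` cdom psi).
  apply: nbhs_preimage_open; [exact: Gc | exact: cdom_open | exact: qy].
apply: filterS (near_chart py yq) => w [_ Gw _].
by rewrite /T /F /transition /= cmapK.
Qed.

Let dT ds : differentiable (Defs.iterD ds T) (cmap psi (G y)).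
Proof.
by have sT := (akappa apsi).2; apply: (sT ds); exists (G y).
Qed.

Lemma differentiable_map_chart :
  differentiable (cmap kappa \o G \o cinv phi) (cmap phi y).
Proof.
apply: (differentiable_near near_smooth_map_chart).
apply: (@differentiable_comp _ _ _ _ F T); first exact: smooth_map_chart_diff [::].
by rewrite Fy; exact: dT [::].
Qed.

Lemma derive_map_chart u :
  'D_u (cmap kappa \o G \o cinv phi) (cmap phi y)
  = 'D_('D_u F (cmap phi y)) T (cmap psi (G y)).
Proof.
rewrite -(near_eq_derive u near_smooth_map_chart).
rewrite (@derive_comp _ _ _ _ F T) ?Fy //; first exact: smooth_map_chart_diff [::].
exact: dT [::].
Qed.

End AtPoint.

Variables (phi : chart K n Y) (y : Y) (j : 'I_m).
Hypotheses (aphi : atlas Y phi) (py : cdom phi y) (ky : cdom kappa (G y)).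

Let f (z : Y) : K := cmap kappa (G z) 0 j.

Lemma differentiable_map_coord : differentiable (f \o cinv phi) (cmap phi y).
Proof.
have [psi apsi qy] := atlas_cover (G y).
apply: (@differentiable_comp _ _ _ _ (cmap kappa \o G \o cinv phi)
  (fun M : 'rV[K]_m => M 0 j)); first exact: (differentiable_map_chart aphi apsi).
exact: differentiable_coord.
Qed.

Lemma derive_map_coord u : 'D_u (f \o cinv phi) (cmap phi y)
  = 'D_u (cmap kappa \o G \o cinv phi) (cmap phi y) 0 j.
Proof.
have [psi apsi qy] := atlas_cover (G y).
by rewrite -derive_coord //; exact: (differentiable_map_chart aphi apsi).
Qed.

End SmoothMaps.

Section C1.
Variables (K : numFieldType) (n m : nat) (Y : manifold K n) (X : manifold K m).
Variables (G : Y -> X) (kappa : chart K m X).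
Hypotheses (sG : smooth_map_on setT G) (akappa : admissible kappa).
Variables (phi : chart K n Y) (y : Y) (j : 'I_m).
Hypotheses (aphi : atlas Y phi) (py : cdom phi y) (ky : cdom kappa (G y)).

(** By the chain rule through a chart of the atlas of X, this derivative is a
    sum of products of derivatives of the transition map and of G, which are
    differentiable and hence continuous. *)
Lemma derive_map_coord_cont u : {for cmap phi y, continuous
  (fun w => 'D_u ((fun z => cmap kappa (G z) 0 j) \o cinv phi) w)}.
Proof.
have [psi apsi qy] := atlas_cover (G y).
pose F := cmap psi \o G \o cinv phi; pose T := transition psi kappa.
have FE : F (cmap phi y) = cmap psi (G y) by rewrite /F /= cmapK.
apply: (@near_continuous _ _ (fun w => \sum_k ('D_u F w) 0 k *
  ('D_(delta_mx 0 k) T (F w)) 0 j)).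
  have yA : nbhs y (G @^-1` (cdom psi `&` cdom kappa)).
    apply: nbhs_preimage_open; first exact: sG.1.
      by apply: openI; exact: cdom_open.
    by [].
  apply: filterS (near_chart py yA) => w [pw [qw kw] E].
  have dT : differentiable T (cmap psi (G (cinv phi w))).
    by apply: compatible_differentiable => //; exact: (akappa apsi).2.
  have FwE : F w = cmap psi (G (cinv phi w)) by [].
  rewrite -{3}E derive_map_coord // (derive_map_chart sG akappa aphi apsi) //.
  rewrite E FwE (derive_rowE (f := T)) // summxE.
  by apply: eq_bigr => k _; rewrite mxE.
apply: continuous_at_sum => k; apply: continuous_atM.
  apply: (@continuous_at_comp _ _ _ ('D_u F) (fun M : 'rV[K]_m => M 0 k));
    last exact: coord_continuous.
  apply: differentiable_continuous.
  exact: (smooth_map_chart_diff sG aphi apsi py qy [:: u]).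
apply: (@continuous_at_comp _ _ _ (fun w => 'D_(delta_mx 0 k) T (F w))
  (fun M : 'rV[K]_m => M 0 j)); last exact: coord_continuous.
apply: (@continuous_at_comp _ _ _ F ('D_(delta_mx 0 k) T)).
  apply: differentiable_continuous.
  exact: (smooth_map_chart_diff sG aphi apsi py qy [::]).
rewrite FE; apply: differentiable_continuous.
by have sT := (akappa apsi).2; apply: (sT [:: delta_mx 0 k]); exists (G y).
Qed.

End C1.

(** If the differentials of the first two coordinates of kappa o G both vanished
    at y, then the differential of G would have rank at most n on a space of
    dimension n + 1, and G would not be an immersion. The first one does vanish, as
    G takes its values in the hypersurface where that coordinate is zero. *)
Lemma second_coord_nondegenerate (K : numFieldType) n (Y : manifold K n.+1)
    (X : manifold K n.+2) (G : Y -> X) (kappa : chart K n.+2 X)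
    (phi : chart K n.+1 Y) (y : Y) :
  smooth_map_on setT G -> immersion G -> admissible kappa -> atlas Y phi ->
  cdom phi y -> cdom kappa (G y) ->
  (forall z, cdom kappa (G z) -> cmap kappa (G z) 0 0 = 0) ->
  exists u, 'D_u ((fun z => cmap kappa (G z) 0 1) \o cinv phi) (cmap phi y) != 0.
Proof.
move=> sG imG akappa aphi py ky G0; apply: contrapT => nex.
have v0 u : 'D_u ((fun z => cmap kappa (G z) 0 1) \o cinv phi) (cmap phi y) = 0.
  by apply: contrapT => /eqP h; apply: nex; exists u.
have [psi apsi qy] := atlas_cover (G y).
pose H := cmap kappa \o G \o cinv phi.
have dH : differentiable H (cmap phi y).
  exact: (differentiable_map_chart sG akappa aphi apsi).
have u0 u : 'D_u ((fun z => cmap kappa (G z) 0 0) \o cinv phi) (cmap phi y) = 0.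
  have yA : nbhs y (G @^-1` cdom kappa).
    by apply: nbhs_preimage_open; [exact: sG.1 | exact: cdom_open | exact: ky].
  rewrite (@near_eq_derive _ _ _ _ (fun=> 0)) ?derive_cst //.
  by apply: filterS (near_chart py yA) => w [_ kw _] /=; exact: G0.
(* A vector killed by J is killed by all the coordinates of dH, since the first
   two differentials vanish. *)
pose J : 'M[K]_(n.+1, n) :=
  \matrix_(i, k) ('D_(delta_mx 0 i) H (cmap phi y)) 0 (lift 0 (lift 0 k)).
have [u uJ un0] : exists2 u : 'rV[K]_n.+1, u *m J = 0 & u != 0.
  have /rowV0Pn[u /sub_kermxP uJ un0] : kermx J != 0.
    rewrite kermx_eq0 /row_free neq_ltn; apply/orP; left.
    by rewrite ltnS rank_leq_col.
  by exists u.
have DH : 'D_u H (cmap phi y) = 0.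
  apply/rowP => k; rewrite [RHS]mxE.
  have [->|k0] := eqVneq k 0; first by rewrite -derive_map_coord.
  have [->|k1] := eqVneq k 1; first by rewrite -derive_map_coord.
  have [k' ->] : exists k', k = lift 0 (lift 0 k').
    case: (unliftP 0 k) k0 k1 => [k1 ->|->]; last by rewrite eqxx.
    case: (unliftP 0 k1) => [k' -> _ _|-> _]; first by exists k'.
    by rewrite (_ : lift 0 0 = 1) ?eqxx //; exact: val_inj.
  have := congr1 (fun M : 'rV_n => M 0 k') uJ; rewrite !mxE => <-.
  rewrite derive_rowE // summxE; apply: eq_bigr => i _.
  by rewrite !mxE.
case/eqP: un0; apply: (imG phi psi y) => //.
have cpk : compatible kappa psi := (akappa psi apsi).1.
rewrite (@near_eq_derive _ _ _ _ (transition kappa psi \o H)).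
  rewrite derive_comp // ?DH ?derive0 //.
  rewrite /H /= cmapK //; exact: compatible_differentiable.
have yA : nbhs y (G @^-1` cdom kappa).
  by apply: nbhs_preimage_open; [exact: sG.1 | exact: cdom_open | exact: ky].
by apply: filterS (near_chart py yA) => w [_ kw _]; rewrite /transition /H /= cmapK.
Qed.

(** * Restriction of trivialisations to a subspace *)

Section Restriction.
Variables (R : realType) (B : topologicalType) (A U : set B).

Definition restrict_point (x : (val @^-1` U : set A)) : U :=
  in_sub (mem_set (set_valP x : U (val (val x)))).

Lemma restrict_point_cont : continuous restrict_point.
Proof.
move=> x; apply: continuous_to_val.
apply: (@continuous_at_comp _ _ _ (fun x : (val @^-1` U : set A) => val x)
  (fun y : A => val y)); exact: continuous_val.
Qed.

Lemma open_restrict : open U -> open (val @^-1` U : set A).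
Proof.
move=> oU; apply: (@open_preimage_at _ _ (fun y : A => val y) U oU) => x _.
exact: continuous_val.
Qed.

Section Circle.
Variables (P : circle_space R B) (tau : circle_triv P U).

Fact restrict_sec_subproof (x : (val @^-1` U : set A) * circle R) :
  ct_sec tau (restrict_point x.1, x.2) \in @cproj _ _ P @^-1` A.
Proof. by apply/mem_set; rewrite /= ct_proj_sec; exact: (set_valP (val x.1)). Qed.

Program Definition restrict_circle_triv :
    circle_triv (restrict_circle A P) (val @^-1` U) :=
  @CircleTriv _ _ (restrict_circle A P) (val @^-1` U) _
    (fun p => ct_phase tau (val p)) (fun x => in_sub (restrict_sec_subproof x))
    _ _ _ _ _ _ _.
Next Obligation. exact: open_restrict (ct_open tau). Qed.
Next Obligation.
move=> p Up; apply: continuous_to_val.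
apply: (@continuous_at_comp _ _ _ (fun p : restrict_circle A P => val p)
  (@cproj _ _ P)).
  exact: continuous_val.
exact: ct_proj_cont tau _ Up.
Qed.
Next Obligation.
move=> p Up; apply: (@continuous_at_comp _ _ _
  (fun p : restrict_circle A P => val p) (ct_phase tau)).
  exact: continuous_val.
exact: ct_phase_cont tau _ Up.
Qed.
Next Obligation.
move=> x; apply: continuous_to_val.
apply: (@continuous_at_comp _ _ _ (fun x : (val @^-1` U : set A) * circle R =>
  (restrict_point x.1, x.2)) (ct_sec tau)); last exact: ct_sec_cont.
apply: continuous_at_pair; last exact: continuous_at_snd.
apply: (continuous_at_comp (@continuous_at_fst _ _ x)).
exact: restrict_point_cont.
Qed.
Next Obligation. by move=> x; apply: val_inj; rewrite /= ct_proj_sec. Qed.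
Next Obligation. by move=> x; rewrite /= ct_phase_sec. Qed.
Next Obligation.
move=> p q Up pq h; apply: val_inj; apply: (ct_inj (c := tau)) => //.
by rewrite -[LHS]/(val (rc_proj p)) -[RHS]/(val (rc_proj q)); congr val.
Qed.
Next Obligation. by move=> a p Up; rewrite /= ct_phase_act. Qed.

End Circle.

Section Line.
Variables (E : vector_family R B) (tau : line_triv E U).

Fact restrict_vec_subproof (x : (val @^-1` U : set A) * CC R) :
  lt_vec tau (restrict_point x.1, x.2) \in @vproj _ _ E @^-1` A.
Proof. by apply/mem_set; rewrite /= lt_proj_vec; exact: (set_valP (val x.1)). Qed.

Let same_proj (e e' : restrict_vector A E) :
  vproj e = vproj e' -> vproj (val e) = vproj (val e').
Proof.
by move=> h; rewrite -[LHS]/(val (rv_proj e)) -[RHS]/(val (rv_proj e')); congr val.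
Qed.

Program Definition restrict_line_triv :
    line_triv (restrict_vector A E) (val @^-1` U) :=
  @LineTriv _ _ (restrict_vector A E) (val @^-1` U) _
    (fun e => lt_coord tau (val e)) (fun x => in_sub (restrict_vec_subproof x))
    _ _ _ _ _ _ _ _.
Next Obligation. exact: open_restrict (lt_open tau). Qed.
Next Obligation.
move=> e Ue; apply: continuous_to_val.
apply: (@continuous_at_comp _ _ _ (fun e : restrict_vector A E => val e)
  (@vproj _ _ E)).
  exact: continuous_val.
exact: lt_proj_cont tau _ Ue.
Qed.
Next Obligation.
move=> e Ue; apply: (@continuous_at_comp _ _ _
  (fun e : restrict_vector A E => val e) (lt_coord tau)).
  exact: continuous_val.
exact: lt_coord_cont tau _ Ue.
Qed.
Next Obligation.
move=> x; apply: continuous_to_val.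
apply: (@continuous_at_comp _ _ _ (fun x : (val @^-1` U : set A) * CC R =>
  (restrict_point x.1, x.2)) (lt_vec tau)); last exact: lt_vec_cont.
apply: continuous_at_pair; last exact: continuous_at_snd.
apply: (continuous_at_comp (@continuous_at_fst _ _ x)).
exact: restrict_point_cont.
Qed.
Next Obligation. by move=> x; apply: val_inj; rewrite /= lt_proj_vec. Qed.
Next Obligation. by move=> x; rewrite /= lt_coord_vec. Qed.
Next Obligation.
move=> e e' Ue ee' h; apply: val_inj; apply: (lt_inj (l := tau)) => //.
exact: same_proj.
Qed.
Next Obligation.
by move=> e e' Ue ee'; rewrite /= lt_coord_add //; exact: same_proj.
Qed.
Next Obligation. by move=> a e Ue; rewrite /= lt_coord_scale. Qed.

End Line.
End Restriction.

(** * The local equations of Q given by semistable charts *)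

Section LocalEquations.
Variables (R : realType) (Zt1 Zt2 : manifold (CC R) 3) (X : manifold (CC R) 4).
Variables (i1 : Zt1 -> X) (i2 : Zt2 -> X) (t : X -> CC R) (Q : set Zt1).
Hypotheses (si1 : smooth_map_on setT i1) (imi1 : immersion i1).
Hypothesis Qi2 : forall y, Q y -> range i2 (i1 y).
Hypothesis Qadapted : forall y, Q y -> exists2 psi, adapted_chart Q psi & cdom psi y.

Local Notation semistable := (semistable_chart i1 i2 t).
Local Notation dom := (@fp_base R Zt1 Zt2 X i1 i2 t Q).

(** The differential at y of the local equation v of Q, in the chart phi; on
    the normal bundle it is the coordinate given by kappa. *)
Definition dlocal (kappa : chart (CC R) 4 X) (phi : chart (CC R) 3 Zt1) (y : Zt1)
    (u : 'rV[CC R]_3) : CC R :=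
  'D_u (local_eq i1 kappa \o cinv phi) (cmap phi y).

Section AtPoint.
Variables (kappa : chart (CC R) 4 X) (phi : chart (CC R) 3 Zt1) (y : Zt1).
Hypotheses (sk : semistable kappa) (ky : cdom kappa (i1 y)).
Hypotheses (aphi : atlas Zt1 phi) (py : cdom phi y).

Lemma local_eq_diff : differentiable (local_eq i1 kappa \o cinv phi) (cmap phi y).
Proof. exact: (differentiable_map_coord si1 sk.1). Qed.

Lemma dlocal_cont u : {for cmap phi y, continuous
  (fun w => 'D_u (local_eq i1 kappa \o cinv phi) w)}.
Proof. exact: (derive_map_coord_cont si1 sk.1). Qed.

(** The component Zt1 lies in the hypersurface u = 0, hence v restricted to it
    has a nonzero differential. *)
Lemma dlocal_neq0 : exists u, dlocal kappa phi y u != 0.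
Proof.
apply: (second_coord_nondegenerate si1 imi1 sk.1) => // z kz.
by have [_ h _] := sk.2 _ kz; apply/h; exists z.
Qed.

Lemma near_local_eq0 : \forall z \near y, Q z -> local_eq i1 kappa z = 0.
Proof.
have yk : nbhs y (i1 @^-1` cdom kappa).
  by apply: nbhs_preimage_open; [exact: si1.1 | exact: cdom_open | exact: ky].
apply: filterS yk => z kz Qz; have [_ _ h] := sk.2 _ kz.
by apply/h; exact: Qi2.
Qed.

Lemma dlocalE u :
  dlocal kappa phi y u = \sum_i u 0 i * dlocal kappa phi y (delta_mx 0 i).
Proof. by rewrite /dlocal derive_rowE //; exact: local_eq_diff. Qed.

Lemma dlocalZ a u : dlocal kappa phi y (a *: u) = a * dlocal kappa phi y u.
Proof.
have := deriveZD a u 0 local_eq_diff.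
by rewrite addr0 derive0 addr0.
Qed.

Lemma dlocalD u w :
  dlocal kappa phi y (u + w) = dlocal kappa phi y u + dlocal kappa phi y w.
Proof.
by have := deriveZD 1 u w local_eq_diff; rewrite !scale1r.
Qed.

Lemma dlocal_onto z : exists u, dlocal kappa phi y u = z.
Proof.
have [u u0] := dlocal_neq0; exists ((z / dlocal kappa phi y u) *: u).
by rewrite dlocalZ divfK.
Qed.

End AtPoint.

(** The differentials of f and of v are both proportional to the conormal
    direction, and that of v is nonzero. *)
Lemma derive_proportional (kappa : chart (CC R) 4 X) y (f : Zt1 -> CC R) :
  semistable kappa -> cdom kappa (i1 y) -> Q y ->
  (forall phi, atlas Zt1 phi -> cdom phi y ->
     differentiable (f \o cinv phi) (cmap phi y)) ->
  (\forall z \near y, Q z -> f z = 0) ->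
  exists c, forall phi, atlas Zt1 phi -> cdom phi y ->
    forall u, 'D_u (f \o cinv phi) (cmap phi y) = c * dlocal kappa phi y u.
Proof.
move=> sk ky Qy df f0; have [psi ad qy] := Qadapted Qy.
have [phi0 aphi0 py0] := atlas_cover y.
pose a g := 'D_(delta_mx 0 0) (g \o cinv psi) (cmap psi y) : CC R.
have D phi (aphi : atlas Zt1 phi) (py : cdom phi y) u :
    dlocal kappa phi y u = conormal psi y phi u * a (local_eq i1 kappa).
  apply: (derive_conormal ad qy Qy aphi py); first exact: local_eq_diff.
  exact: near_local_eq0.
have v0 : a (local_eq i1 kappa) != 0.
  have [u] := dlocal_neq0 sk ky aphi0 py0.
  by apply: contraNneq => v0; rewrite D // v0 mulr0.
exists (a f / a (local_eq i1 kappa)) => phi aphi py u.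
rewrite D // (derive_conormal ad qy Qy aphi py) //; last exact: df.
by rewrite mulrCA divfK // mulrC.
Qed.

Section Ratio.
Variables kappa kappa' : chart (CC R) 4 X.

Lemma changes_by_exists y : Q y -> semistable kappa -> cdom kappa (i1 y) ->
  semistable kappa' -> cdom kappa' (i1 y) ->
  exists2 a, a != 0 & changes_by i1 kappa kappa' y a.
Proof.
move=> Qy sk ky sk' ky'.
have [|a ha] := @derive_proportional kappa y (local_eq i1 kappa') sk ky Qy _
    (near_local_eq0 sk' ky').
  by move=> phi aphi py; exact: local_eq_diff.
exists a => //; have [phi aphi py] := atlas_cover y.
have [u] := dlocal_neq0 sk' ky' aphi py.
by apply: contraNneq => a0; rewrite /dlocal ha // a0 mul0r.
Qed.

Lemma changes_by_uniq y a b : semistable kappa -> cdom kappa (i1 y) ->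
  changes_by i1 kappa kappa' y a -> changes_by i1 kappa kappa' y b -> a = b.
Proof.
move=> sk ky ha hb; have [phi aphi py] := atlas_cover y.
have [u u0] := dlocal_neq0 sk ky aphi py.
by apply: (mulIf u0); rewrite -[LHS](ha phi aphi py) -[RHS](hb phi aphi py).
Qed.

(** The value at y of the unit a with v' = a v; it is determined by dv' = a dv,
    since dv does not vanish. *)
Definition unit_ratio (y : Zt1) : CC R :=
  xget 1 [set a : CC R | a != 0 /\ changes_by i1 kappa kappa' y a].

Lemma unit_ratio_neq0 y : unit_ratio y != 0.
Proof. by rewrite /unit_ratio; case: xgetP => [a -> [] //|_]; exact: oner_neq0. Qed.

Lemma unit_ratioP (x : Q) : (dom kappa) x -> (dom kappa') x ->
  changes_by i1 kappa kappa' (val x) (unit_ratio (val x)).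
Proof.
move=> [sk ky] [sk' ky']; rewrite /unit_ratio; case: xgetP => [a _ [] //|h].
have [a a0 ha] := changes_by_exists (set_valP x) sk ky sk' ky'.
by case: (h a).
Qed.

Lemma dlocal_pt_cont phi (x : Q) u : semistable kappa -> cdom kappa (i1 (val x)) ->
  atlas Zt1 phi -> cdom phi (val x) ->
  {for x, continuous (fun z : Q => dlocal kappa phi (val z) u)}.
Proof.
move=> sk kx aphi px.
apply: (@continuous_at_comp _ _ _ (fun z : Q => cmap phi (val z))
  (fun w => 'D_u (local_eq i1 kappa \o cinv phi) w)); last exact: dlocal_cont.
apply: (@continuous_at_comp _ _ _ (fun z : Q => val z) (cmap phi)).
  exact: continuous_val.
exact: cmap_cont.
Qed.

Lemma open_dom : open (dom kappa).
Proof.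
have [sk|nsk] := pselect (semistable kappa); last first.
  rewrite (_ : dom kappa = set0); first exact: open0.
  by apply/seteqP; split=> // x [].
rewrite (_ : dom kappa = (fun x : Q => i1 (val x)) @^-1` cdom kappa); last first.
  by apply/seteqP; split=> [x []|x ?].
apply: open_preimage_at; first exact: cdom_open.
move=> x _; apply: (@continuous_at_comp _ _ _ (fun x : Q => val x) i1).
  exact: continuous_val.
exact: si1.1.
Qed.

End Ratio.

Lemma unit_ratio_uniq kappa kappa' (x : Q) a : (dom kappa) x -> (dom kappa') x ->
  changes_by i1 kappa kappa' (val x) a -> unit_ratio kappa kappa' (val x) = a.
Proof.
move=> dx dx' ha; apply: (changes_by_uniq dx.1 dx.2 _ ha).
exact: unit_ratioP.
Qed.

(** Near x it is the quotient of the derivatives of v' and v along a fixed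
    vector on which dv does not vanish. *)
Lemma unit_ratio_cont kappa kappa' (x : Q) : (dom kappa) x -> (dom kappa') x ->
  {for x, continuous (fun z : Q => unit_ratio kappa kappa' (val z))}.
Proof.
move=> dx dx'; have [phi aphi px] := atlas_cover (val x).
have [u u0] := dlocal_neq0 dx.1 dx.2 aphi px.
have dc k (dkx : (dom k) x) :
    {for x, continuous (fun z : Q => dlocal k phi (val z) u)}.
  by apply: dlocal_pt_cont => //; [exact: dkx.1 | exact: dkx.2].
apply: (@continuous_at_eq_on _ _
  (fun z : Q => dlocal kappa' phi (val z) u / dlocal kappa phi (val z) u) _ _
  ([set z | (dom kappa) z /\ (dom kappa') z] `&`
   [set z | cdom phi (val z) /\ dlocal kappa phi (val z) u != 0])).
- apply: filterI; first apply: filterI.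
  + by apply: open_nbhs_nbhs; split=> //; exact: open_dom.
  + by apply: open_nbhs_nbhs; split=> //; exact: open_dom.
  apply: filterI; last first.
    exact: (near_neq0 (f := fun z : Q => dlocal kappa phi (val z) u) u0 (dc _ dx)).
  apply: nbhs_preimage_open; [exact: continuous_val | exact: cdom_open | exact: px].
- move=> z [[dz dz'] [pz z0]]; have h := unit_ratioP dz dz' aphi pz u.
  by rewrite [X in X / _]/dlocal h mulfK.
by apply: continuous_atM; [exact: dc | apply: continuous_atV => //; exact: dc].
Qed.

Lemma unit_ratioM k1 k2 k3 (x : Q) : (dom k1) x -> (dom k2) x -> (dom k3) x ->
  unit_ratio k1 k3 (val x) = unit_ratio k2 k3 (val x) * unit_ratio k1 k2 (val x).
Proof.
move=> d1 d2 d3; apply: unit_ratio_uniq => // phi aphi px u.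
by rewrite (unit_ratioP d2 d3 aphi px) (unit_ratioP d1 d2 aphi px) mulrA.
Qed.

Lemma unit_ratio_id k (x : Q) : (dom k) x -> unit_ratio k k (val x) = 1.
Proof. by move=> d; apply: unit_ratio_uniq => // phi _ _ u; rewrite mul1r. Qed.

End LocalEquations.

(** * Trivialisations of the fixed-phase bundle *)

Section FixedPhaseTrivialisation.
Variables (R : realType) (Zt1 Zt2 : manifold (CC R) 3) (X : manifold (CC R) 4).
Variables (i1 : Zt1 -> X) (i2 : Zt2 -> X) (t : X -> CC R) (Q : set Zt1).
Variable theta : R.
Hypotheses (si1 : smooth_map_on setT i1) (imi1 : immersion i1).
Hypothesis Qi2 : forall y, Q y -> range i2 (i1 y).
Hypothesis Qadapted : forall y, Q y -> exists2 psi, adapted_chart Q psi & cdom psi y.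

Local Notation dom := (@fp_base R Zt1 Zt2 X i1 i2 t Q).
Local Notation P := (fixed_phase_bundle i1 i2 t Q theta).
Local Notation coord := (@fp_coord R Zt1 Zt2 X i1 i2 t Q theta).
Local Notation rat := (@unit_ratio R Zt1 X i1).

Lemma fp_class_eqP (p q : coord) : fp_class p = fp_class q <-> fp_rel p q.
Proof. by rewrite /fp_class; split=> [/eqmodP|h]; last exact/eqmodP. Qed.

Lemma fp_class_surj (e : P) : exists p : coord, e = fp_class p.
Proof. by exists (fp_repr e); rewrite fp_classK. Qed.

Lemma fp_cproj_class (p : coord) : cproj (fp_class p : P) = fp_point p.
Proof. exact: fp_proj_class. Qed.

Lemma fp_dom (p : coord) : dom (projT1 p) (fp_point p).
Proof. exact: set_valP (projT2 p).1. Qed.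

(** The phase in kappa of a point whose phase is given in another chart: the
    gluing multiplies it by a / |a|. *)
Definition coord_phase (kappa : chart (CC R) 4 X) (p : coord) : circle R :=
  circleM (phase (rat (projT1 p) kappa (val (fp_point p)))) (fp_phase p).2.

(** Two points given in different charts are glued together exactly when they
    have the same phase in a third one. *)
Lemma fp_relP kappa (p q : coord) : dom kappa (fp_point p) ->
  fp_rel p q <-> fp_point p = fp_point q /\ coord_phase kappa p = coord_phase kappa q.
Proof.
move=> dp; have p1 := fp_dom p; have q1 := fp_dom q.
have E : fp_point p = fp_point q -> coord_phase kappa p =
    circleM (phase (rat (projT1 q) kappa (val (fp_point q))))
      (circleM (phase (rat (projT1 p) (projT1 q) (val (fp_point p)))) (fp_phase p).2).
  move=> pq; rewrite /coord_phase circleMA -phaseM ?unit_ratio_neq0 //.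
  congr circleM; congr phase.
  have q1' : dom (projT1 q) (fp_point p) by rewrite pq.
  by rewrite -pq (unit_ratioM si1 imi1 Qi2 Qadapted p1 q1' dp).
split=> [/asboolP[pq [a [a0 ha va]]]|[pq h]].
  split=> //; rewrite E // /coord_phase; congr circleM; apply: val_inj.
  have -> : rat (projT1 p) (projT1 q) (val (fp_point p)) = a.
    apply: (unit_ratio_uniq si1 imi1 Qi2 Qadapted (x := fp_point p) p1 _ ha).
    by rewrite pq.
  by rewrite /= (negbTE a0) va.
apply/asboolP; split=> //; exists (rat (projT1 p) (projT1 q) (val (fp_point p))).
split; first exact: unit_ratio_neq0.
  apply: (unit_ratioP si1 imi1 Qi2 Qadapted (x := fp_point p) p1).
  by rewrite pq.
move: h; rewrite E // => /circleMI <-.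
by rewrite -val_phase ?unit_ratio_neq0.
Qed.

Definition fp_trivial_phase kappa (e : P) : circle R := coord_phase kappa (fp_repr e).

Lemma fp_trivial_phase_class kappa (p : coord) : dom kappa (fp_point p) ->
  fp_trivial_phase kappa (fp_class p) = coord_phase kappa p.
Proof.
move=> dp; symmetry; have h := fp_repr_class p.
by have [_ ->] := (fp_relP _ dp).1 h.
Qed.

Fact phase_pair_subproof (a : circle R) :
  (circleM (circle_expi theta) (circleV a), a) \in
  [set r : circle R * circle R | circleM r.1 r.2 = circle_expi theta].
Proof.
apply/mem_set => /=; rewrite -circleMA circleVM.
by apply: val_inj; rewrite /= mulr1.
Qed.

(** The point of the fibre with rho_2 = a. *)
Definition phase_pair (a : circle R) : phase_fibre theta :=
  in_sub (phase_pair_subproof a).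

Lemma phase_pair_cont : continuous phase_pair.
Proof.
move=> a; apply: continuous_to_val; apply: continuous_at_pair; last exact: cvg_id.
apply: (@continuous_at_comp _ _ _ (fun a => (circle_expi theta, circleV a))
  (fun ab : circle R * circle R => circleM ab.1 ab.2));
  last exact: continuous_circleM.
by apply: continuous_at_pair; [exact: cst_continuous | exact: continuous_circleV].
Qed.

Definition fp_section kappa (x : dom kappa * circle R) : P :=
  fp_class (existT _ kappa (x.1, phase_pair x.2) : coord).

Lemma fp_proj_cont : continuous (@cproj _ _ P).
Proof.
move=> e; apply: (@quotient_continuous_at coord _ _ setT) => // [|p _]; first exact: openT.
apply: (@continuous_at_eq coord _ (@fp_point _ _ _ _ _ _ _ _ _)) => [q|].
  by rewrite -[RHS]/(fp_proj (fp_class q)) fp_proj_class.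
case: p => k x; apply: continuous_at_existT.
apply: (@continuous_at_comp _ _ _ fst (fun x : dom k => val x)).
  exact: continuous_at_fst.
exact: continuous_val.
Qed.

Lemma coord_phase_cont kappa (p : coord) : dom kappa (fp_point p) ->
  {for p, continuous (coord_phase kappa)}.
Proof.
case: p => k [x r] dp; apply: continuous_at_existT.
apply: (@continuous_at_comp _ _ _
  (fun y : dom k * phase_fibre theta =>
    (phase (rat k kappa (val (val y.1))), (val y.2).2))
  (fun ab : circle R * circle R => circleM ab.1 ab.2));
  last exact: continuous_circleM.
apply: continuous_at_pair.
  apply: (@continuous_at_comp _ _ _ (fun y : dom k * phase_fibre theta =>
    rat k kappa (val (val y.1))) (@phase R));
    last exact: continuous_phase (unit_ratio_neq0 _ _ _ _).
  apply: (@continuous_at_comp _ _ _ (fun y : dom k * phase_fibre theta => val y.1)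
    (fun z : Q => rat k kappa (val z))).
    apply: (@continuous_at_comp _ _ _ fst (fun x : dom k => val x)).
      exact: continuous_at_fst.
    exact: continuous_val.
  apply: (unit_ratio_cont si1 imi1 Qi2 Qadapted (x := val x) _ dp).
  exact: (fp_dom (existT _ k (x, r) : coord)).
apply: (@continuous_at_comp _ _ _ (fun y : dom k * phase_fibre theta => val y.2)
  (@snd (circle R) (circle R))); last exact: continuous_at_snd.
apply: (@continuous_at_comp _ _ _ snd (fun x : phase_fibre theta => val x)).
  exact: continuous_at_snd.
exact: continuous_val.
Qed.

Lemma open_fp_over kappa : open [set e : P | dom kappa (cproj e)].
Proof.
apply: (@open_preimage_at _ _ (@cproj _ _ P) (dom kappa)).
  exact: open_dom.
by move=> e _; exact: fp_proj_cont.
Qed.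

Lemma fp_continuous_at kappa (S : topologicalType) (f : P -> S) :
  (forall p : coord, dom kappa (fp_point p) ->
     {for p, continuous (fun q : coord => f (fp_class q))}) ->
  forall e, dom kappa (cproj e) -> {for e, continuous f}.
Proof.
move=> cf e de; apply: (@quotient_continuous_at coord _ _
  [set e : P | dom kappa (cproj e)] f _ _ e de).
  exact: open_fp_over.
move=> p dp; apply: cf; rewrite -fp_proj_class; exact: dp.
Qed.

Program Definition fixed_phase_triv kappa : circle_triv P (dom kappa) :=
  @CircleTriv _ _ P (dom kappa) _ (fp_trivial_phase kappa) (@fp_section kappa)
    _ _ _ _ _ _ _.
Next Obligation. by move=> kappa; exact: open_dom. Qed.
Next Obligation. by move=> kappa e _; exact: fp_proj_cont. Qed.
Next Obligation.
move=> kappa e de; apply: (fp_continuous_at _ de) => p dp'.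
apply: (@continuous_at_eq_on coord _ (coord_phase kappa) _ _
  [set q | dom kappa (fp_point q)]) => [|q dq|].
- have pc : {for p, continuous (@fp_point _ _ _ _ i1 i2 t Q theta)}.
    case: (p) => k x; apply: continuous_at_existT.
    apply: (@continuous_at_comp _ _ _ fst (fun x : dom k => val x)).
      exact: continuous_at_fst.
    exact: continuous_val.
  by apply: (nbhs_preimage_open pc); [exact: open_dom | exact: dp'].
- by rewrite fp_trivial_phase_class.
exact: coord_phase_cont.
Qed.
Next Obligation.
move=> kappa x; apply: (@continuous_at_comp _ _ _ (fun x : dom kappa * circle R =>
  existT _ kappa (x.1, phase_pair x.2) : coord) (fun p => fp_class p : P)).
  apply: (@continuous_at_comp _ _ _ (fun x : dom kappa * circle R =>
    (x.1, phase_pair x.2))); last exact: existT_continuous.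
  apply: continuous_at_pair; first exact: continuous_at_fst.
  apply: (@continuous_at_comp _ _ _ snd phase_pair); first exact: continuous_at_snd.
  exact: phase_pair_cont.
exact: continuous_pi_quotient.
Qed.
Next Obligation. by move=> kappa x; rewrite [LHS]fp_proj_class. Qed.
Next Obligation.
move=> kappa [x a]; rewrite fp_trivial_phase_class; last exact: set_valP x.
rewrite /coord_phase /= (unit_ratio_id si1 imi1 Qi2 Qadapted (set_valP x)).
by apply: val_inj; rewrite /= oner_eq0 normr1 divr1 mul1r.
Qed.
Next Obligation.
move=> kappa e e'; have [p ->] := fp_class_surj e; have [q ->] := fp_class_surj e'.
rewrite !fp_cproj_class => dp pq; rewrite !fp_trivial_phase_class -?pq // => h.
by apply/fp_class_eqP/(fp_relP _ dp).
Qed.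
Next Obligation.
move=> kappa a e; have [p ->] := fp_class_surj e.
rewrite fp_cproj_class => dp.
have -> : cact a (fp_class p : P) = fp_class (fp_rot a p) := fp_act_class a p.
have dp' : dom kappa (fp_point (fp_rot a p)) by exact: dp.
rewrite (fp_trivial_phase_class dp) (fp_trivial_phase_class dp').
by rewrite /coord_phase [RHS]circleMC -circleMA [circleM _ a]circleMC.
Qed.

(** The transition functions of the fixed-phase bundle are the phases of the
    units a. *)
Lemma fp_phase_transition kappa kappa' (e : P) :
  dom kappa (cproj e) -> dom kappa' (cproj e) ->
  fp_trivial_phase kappa' e =
  circleM (phase (rat kappa kappa' (val (cproj e)))) (fp_trivial_phase kappa e).
Proof.
have [p ->] := fp_class_surj e; rewrite fp_cproj_class => dp dp'.
rewrite (fp_trivial_phase_class dp) (fp_trivial_phase_class dp').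
have E := unit_ratioM si1 imi1 Qi2 Qadapted (fp_dom p) dp dp'.
rewrite /coord_phase E phaseM; [|exact: unit_ratio_neq0..].
by rewrite circleMA.
Qed.

End FixedPhaseTrivialisation.

(** * Trivialisations of the normal bundle *)

Section NormalTrivialisation.
Variables (R : realType) (Zt1 Zt2 : manifold (CC R) 3) (X : manifold (CC R) 4).
Variables (i1 : Zt1 -> X) (i2 : Zt2 -> X) (t : X -> CC R) (Q : set Zt1).
Hypotheses (si1 : smooth_map_on setT i1) (imi1 : immersion i1).
Hypothesis Qi2 : forall y, Q y -> range i2 (i1 y).
Hypothesis Qadapted : forall y, Q y -> exists2 psi, adapted_chart Q psi & cdom psi y.

Local Notation dom := (@fp_base R Zt1 Zt2 X i1 i2 t Q).
Local Notation N := (normal_bundle Q).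
Local Notation coord := (nb_coord Q).
Local Notation rat := (@unit_ratio R Zt1 X i1).

Definition nb_dlocal (kappa : chart (CC R) 4 X) (v : coord) : CC R :=
  nb_derive v (local_eq i1 kappa).

Lemma nb_class_eqP (v w : coord) : nb_class v = nb_class w <-> nb_rel v w.
Proof. by rewrite /nb_class; split=> [/eqmodP|h]; last exact/eqmodP. Qed.

Lemma nb_classK (e : N) : nb_class (nb_repr e) = e.
Proof. exact: reprK. Qed.

Lemma nb_class_surj (e : N) : exists v : coord, e = nb_class v.
Proof. by exists (nb_repr e); rewrite nb_classK. Qed.

Lemma vproj_nb_class (v : coord) : vproj (nb_class v : N) = nb_point v.
Proof. exact: nb_proj_class. Qed.

Lemma nb_chartP (v : coord) :
  atlas Zt1 (projT1 v) /\ cdom (projT1 v) (val (nb_point v)).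
Proof. exact: set_valP (projT2 v).1. Qed.

(** Two vectors are equal in the normal bundle when all functions vanishing on
    Q have the same derivative along them; as these differentials are multiples of
    dv, it suffices to compare dv. Conversely dv is a multiple of the differential
    of the first coordinate of an adapted chart, which is such a function. *)
Lemma nb_relP kappa (v w : coord) : dom kappa (nb_point v) ->
  nb_rel v w <-> nb_point v = nb_point w /\ nb_dlocal kappa v = nb_dlocal kappa w.
Proof.
move=> [sk kv]; have [av pv] := nb_chartP v; have [aw pw] := nb_chartP w.
have Qv : Q (val (nb_point v)) by exact: set_valP.
split=> [/asboolP[vw h]|[vw h]].
  split; first exact: vw.
  have [psi ad qv] := Qadapted Qv.
  have D (u : coord) : nb_point v = nb_point u -> nb_dlocal kappa u =
      nb_derive u (fun y => cmap psi y 0 0) *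
      'D_(delta_mx 0 0) (local_eq i1 kappa \o cinv psi)
        (cmap psi (val (nb_point v))).
    move=> vu; have [au pu] := nb_chartP u; rewrite -vu in pu.
    rewrite /nb_dlocal /nb_derive -vu (derive_conormal ad qv Qv au pu).
    - by rewrite (derive_first_coord ad qv au pu).
    - exact: (local_eq_diff si1 sk).
    - exact: (near_local_eq0 si1 Qi2 sk kv).
  rewrite (D v erefl) (D w vw) h; first by [].
  exact: first_coord_vanishing_germ ad qv.
apply/asboolP; split; first exact: vw.
move=> f [U [oU Uv sf f0]].
have [||c hc] := derive_proportional si1 imi1 Qi2 Qadapted (f := f) sk kv Qv.
- by move=> phi aphi pphi; apply: (sf phi aphi [::]); exists (val (nb_point v)).
- by apply: filterS (open_nbhs_nbhs (conj oU Uv)) => z; exact: f0.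
have Ev : nb_derive v f = c * nb_dlocal kappa v := hc _ av pv _.
rewrite vw in hc; have Ew : nb_derive w f = c * nb_dlocal kappa w := hc _ aw pw _.
exact: etrans Ev (etrans (congr1 (fun z => c * z) h) (esym Ew)).
Qed.

Definition nb_trivial_coord kappa (e : N) : CC R := nb_dlocal kappa (nb_repr e).

Lemma nb_trivial_coord_class kappa (v : coord) : dom kappa (nb_point v) ->
  nb_trivial_coord kappa (nb_class v) = nb_dlocal kappa v.
Proof.
move=> dv; have h : nb_rel v (nb_repr (nb_class v)).
  by apply/nb_class_eqP; rewrite nb_classK.
by have [_ ->] := (nb_relP _ dv).1 h.
Qed.

Lemma nb_point_cont : continuous (@nb_point R 3 Zt1 Q).
Proof.
case=> phi x; apply: continuous_at_existT.
apply: (@continuous_at_comp _ _ _ fst (fun x : nb_base phi => val x)).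
  exact: continuous_at_fst.
exact: continuous_val.
Qed.

Lemma nb_proj_cont : continuous (@vproj _ _ N).
Proof.
move=> e; apply: (@quotient_continuous_at coord _ _ setT) => [|v _|//]; first exact: openT.
apply: (@continuous_at_eq coord _ (@nb_point R 3 Zt1 Q)) => [w|].
  by rewrite -[RHS]/(vproj (nb_class w : N)) vproj_nb_class.
exact: nb_point_cont.
Qed.

Lemma nb_continuous_at kappa (S : topologicalType) (f : N -> S) :
  (forall v : coord, dom kappa (nb_point v) ->
     {for v, continuous (fun w : coord => f (nb_class w))}) ->
  forall e, dom kappa (vproj e) -> {for e, continuous f}.
Proof.
move=> cf e de.
apply: (@quotient_continuous_at coord _ _
  [set e : N | dom kappa (vproj e)] f _ _ e de).
  apply: (@open_preimage_at _ _ (@vproj _ _ N) (dom kappa)); first exact: open_dom.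
  by move=> e' _; exact: nb_proj_cont.
by move=> v dv; apply: cf; rewrite -vproj_nb_class; exact: dv.
Qed.

Lemma nb_dlocal_cont kappa (v : coord) : dom kappa (nb_point v) ->
  {for v, continuous (nb_dlocal kappa)}.
Proof.
case: v => phi x dv; apply: continuous_at_existT.
have [sk kv] := dv; have [aphi px] := nb_chartP (existT _ phi x : coord).
have fc : {for x, continuous (fun y : nb_base phi * 'rV[CC R]_3 => val y.1)}.
  apply: (@continuous_at_comp _ _ _ fst (fun x : nb_base phi => val x)).
    exact: continuous_at_fst.
  exact: continuous_val.
apply: (@continuous_at_eq_on _ _ (fun y : nb_base phi * 'rV[CC R]_3 =>
  \sum_i y.2 0 i * dlocal i1 kappa phi (val (val y.1)) (delta_mx 0 i)) _ _
  [set y | dom kappa (val y.1)]) => [|y [_ ky]|].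
- by apply: (nbhs_preimage_open fc); [exact: open_dom | exact: dv].
- have [_ py] := nb_chartP (existT _ phi y : coord).
  rewrite /nb_dlocal /nb_derive /= -/(dlocal i1 kappa phi _ _).
  by rewrite (dlocalE si1 sk ky aphi py).
apply: continuous_at_sum => i; apply: continuous_atM.
  apply: (@continuous_at_comp _ _ _ snd (fun M : 'rV[CC R]_3 => M 0 i)).
    exact: continuous_at_snd.
  exact: coord_continuous.
apply: (@continuous_at_comp _ _ _ (fun y : nb_base phi * 'rV[CC R]_3 => val y.1)
  (fun z : Q => dlocal i1 kappa phi (val z) (delta_mx 0 i))); first exact: fc.
apply: (dlocal_pt_cont si1); [exact: sk | exact: kv | exact: aphi | exact: px].
Qed.

Lemma nb_unit_vector kappa (x : dom kappa) : exists v : coord,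
  nb_point v = val x /\ nb_dlocal kappa v = 1.
Proof.
have [phi aphi px] := atlas_cover (val (val x)).
have [sk kx] : dom kappa (val x) := set_valP x.
have [u u1] := dlocal_onto si1 imi1 sk kx aphi px 1.
have xP : nb_base phi (val x) by [].
by exists (existT _ phi (in_sub (mem_set xP), u)).
Qed.

Definition nb_section kappa (x : dom kappa * CC R) : N :=
  let v := projT1 (cid (nb_unit_vector x.1)) in
  nb_class (nb_with v (x.2 *: (projT2 v).2)).

Lemma nb_sectionE kappa (x : dom kappa * CC R) : exists v : coord,
  [/\ nb_point v = val x.1, nb_dlocal kappa v = 1
    & nb_section x = nb_class (nb_with v (x.2 *: (projT2 v).2))].
Proof. by rewrite /nb_section; case: cid => v [? ?]; exists v. Qed.

Lemma nb_point_section kappa x : vproj (@nb_section kappa x) = val x.1.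
Proof. by have [v [vx _ ->]] := nb_sectionE x; rewrite vproj_nb_class. Qed.

Lemma nb_dlocalZ kappa (v : coord) a : dom kappa (nb_point v) ->
  nb_dlocal kappa (nb_with v (a *: (projT2 v).2)) = a * nb_dlocal kappa v.
Proof.
by move=> [sk kv]; have [av pv] := nb_chartP v; exact: (dlocalZ si1 sk kv av pv).
Qed.

Lemma nb_coord_section kappa x : nb_trivial_coord kappa (@nb_section kappa x) = x.2.
Proof.
have [v [vx v1 ->]] := nb_sectionE x.
have dv : dom kappa (nb_point v) by rewrite vx; exact: set_valP.
rewrite (nb_trivial_coord_class (v := nb_with v _) dv).
by rewrite (nb_dlocalZ _ dv) v1 mulr1.
Qed.

Lemma nb_coord_inj kappa (e e' : N) : dom kappa (vproj e) -> vproj e = vproj e' ->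
  nb_trivial_coord kappa e = nb_trivial_coord kappa e' -> e = e'.
Proof.
have [v ->] := nb_class_surj e; have [w ->] := nb_class_surj e'.
rewrite !vproj_nb_class => dv vw; have dw : dom kappa (nb_point w) by rewrite -vw.
rewrite (nb_trivial_coord_class dv) (nb_trivial_coord_class dw) => h.
by apply/nb_class_eqP/(nb_relP _ dv).
Qed.

Lemma open_nb_base (phi : chart (CC R) 3 Zt1) : atlas Zt1 phi ->
  open (nb_base phi : set Q).
Proof.
move=> aphi; rewrite (_ : nb_base phi = (fun x : Q => val x) @^-1` cdom phi).
  apply: open_preimage_at; first exact: cdom_open.
  by move=> x _; exact: continuous_val.
by apply/seteqP; split=> [x []|x ?].
Qed.

(** The vector of the section is chosen separately at each point; near x it is
    also represented by a fixed vector u of a fixed chart, divided by dv(u). *)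
Lemma nb_section_cont kappa : continuous (@nb_section kappa).
Proof.
move=> x; have [[phi [x' u]] [xx' u1 _]] := nb_sectionE x.
have [sk kx] : dom kappa (val x.1) := set_valP x.1.
have [aphi px] : nb_base phi (val x.1) by rewrite -xx'; exact: set_valP.
rewrite /nb_dlocal /nb_derive xx' in u1.
have vc : {for x, continuous (fun y : dom kappa * CC R => val y.1)}.
  apply: (@continuous_at_comp _ _ _ fst (fun x : dom kappa => val x)).
    exact: continuous_at_fst.
  exact: continuous_val.
have dc : {for x, continuous (fun y : dom kappa * CC R =>
    dlocal i1 kappa phi (val (val y.1)) u)}.
  apply: (@continuous_at_comp _ _ _ (fun y : dom kappa * CC R => val y.1)
    (fun z : Q => dlocal i1 kappa phi (val z) u)); first exact: vc.
  apply: (dlocal_pt_cont si1); [exact: sk | exact: kx | exact: aphi | exact: px].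
pose a (y : dom kappa * CC R) := y.2 / dlocal i1 kappa phi (val (val y.1)) u.
pose p (y : dom kappa * CC R) : nb_base phi := insubd x' (val y.1).
have u0 : dlocal i1 kappa phi (val (val x.1)) u != 0.
  by rewrite [dlocal _ _ _ _ _]u1 oner_neq0.
have near0 := near_neq0 (f := fun y : dom kappa * CC R =>
    dlocal i1 kappa phi (val (val y.1)) u) u0 dc.
have nearb := nbhs_preimage_open vc (open_nb_base aphi) (conj aphi px).
apply: (@continuous_at_eq_on _ _
  (fun y => nb_class (existT _ phi (p y, a y *: u) : coord) : N) _ _ _
  (filterI near0 nearb)) => [y [/= y0 yb]|].
  have py : val (p y) = val y.1 by rewrite val_insubd mem_set.
  have dy : dom kappa (val y.1) by exact: set_valP.
  have dpy : dom kappa (val (p y)) by rewrite py.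
  apply: (nb_coord_inj (kappa := kappa)).
  - by rewrite vproj_nb_class; exact: dpy.
  - by rewrite vproj_nb_class nb_point_section; exact: py.
  - pose v : coord := existT _ phi (p y, u).
    rewrite nb_coord_section.
    rewrite [LHS](nb_trivial_coord_class (v := nb_with v (a y *: u)) dpy).
    rewrite [LHS](nb_dlocalZ (v := v) (a y) dpy).
    have -> : nb_dlocal kappa v = dlocal i1 kappa phi (val (val y.1)) u by rewrite -py.
    by rewrite divfK.
apply: (@continuous_at_comp _ _ _ (fun y : dom kappa * CC R =>
  existT _ phi (p y, a y *: u) : coord) (fun v => nb_class v : N));
  last exact: continuous_pi_quotient.
apply: (@continuous_at_comp _ _ _ (fun y : dom kappa * CC R => (p y, a y *: u)));
  last exact: existT_continuous.
apply: continuous_at_pair.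
  apply: (continuous_at_comp vc); apply: continuous_insubd; first exact: open_nb_base.
  by [].
apply: (@continuous_at_comp _ _ _ a (fun c : CC R => c *: u));
  last exact: scalel_continuous.
apply: continuous_atM; first exact: continuous_at_snd.
by apply: continuous_atV; [exact: u0 | exact: dc].
Qed.

Lemma nb_coord_add kappa (e e' : N) : dom kappa (vproj e) -> vproj e = vproj e' ->
  nb_trivial_coord kappa (vadd e e') =
  nb_trivial_coord kappa e + nb_trivial_coord kappa e'.
Proof.
rewrite /= /nb_add; set v := nb_repr e => de ee'.
have dv : dom kappa (nb_point v) by [].
have dw u : dom kappa (nb_point (nb_with v u)) by [].
have [sk kv] := dv; have [aphi pv] := nb_chartP v.
have F u : nb_trivial_coord kappa (nb_class (nb_with v u)) =
    dlocal i1 kappa (projT1 v) (val (nb_point v)) u.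
  exact: nb_trivial_coord_class (dw u).
have Ee : nb_trivial_coord kappa e =
    dlocal i1 kappa (projT1 v) (val (nb_point v)) (projT2 v).2 by [].
have [u hu] := dlocal_onto si1 imi1 sk kv aphi pv (nb_trivial_coord kappa e').
have ue' : nb_class (nb_with v u) = e' :> N.
  apply: (nb_coord_inj (kappa := kappa)).
  - by rewrite vproj_nb_class; exact: dw.
  - by rewrite vproj_nb_class -[RHS]ee'.
  - rewrite F hu; reflexivity.
have := xgetPex 0 (ex_intro (fun xi => nb_class (nb_with v xi) = e') u ue').
set xi := xget _ _ => xie'.
rewrite F Ee (dlocalD si1 sk kv aphi pv (projT2 v).2); apply: congr1.
rewrite -(F xi) xie'; reflexivity.
Qed.

Lemma nb_coord_scale kappa a (e : N) : dom kappa (vproj e) ->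
  nb_trivial_coord kappa (vscale a e) = a * nb_trivial_coord kappa e.
Proof.
rewrite /= /nb_scale; set v := nb_repr e => de.
have dw u : dom kappa (nb_point (nb_with v u)) by [].
rewrite (nb_trivial_coord_class (dw _)).
have [sk kv] := de; have [aphi pv] := nb_chartP v.
exact: (dlocalZ si1 sk kv aphi pv).
Qed.

Definition normal_triv kappa : line_triv N (dom kappa).
Proof.
refine (@LineTriv _ _ N (dom kappa) _ (nb_trivial_coord kappa) (@nb_section kappa)
  _ _ (@nb_section_cont kappa) (@nb_point_section kappa) (@nb_coord_section kappa)
  (@nb_coord_inj kappa) (@nb_coord_add kappa) (@nb_coord_scale kappa)).
- exact: open_dom.
- by move=> e _; exact: nb_proj_cont.
- move=> e de; apply: (nb_continuous_at _ de) => v dv.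
  apply: (@continuous_at_eq_on coord _ (nb_dlocal kappa) _ _
    [set w | dom kappa (nb_point w)]) => [|w dw|].
  + by apply: (nbhs_preimage_open (@nb_point_cont v)); [exact: open_dom | exact: dv].
  + by rewrite nb_trivial_coord_class.
  exact: nb_dlocal_cont.
Defined.

(** The transition functions of the normal bundle are the units a. *)
Lemma nb_coord_transition kappa kappa' (e : N) :
  dom kappa (vproj e) -> dom kappa' (vproj e) ->
  nb_trivial_coord kappa' e =
  rat kappa kappa' (val (vproj e)) * nb_trivial_coord kappa e.
Proof.
move=> de de'; have [aphi pv] := nb_chartP (nb_repr e).
exact: (unit_ratioP si1 imi1 Qi2 Qadapted de de' aphi pv).
Qed.

End NormalTrivialisation.

(** * Geometry of the semistable family *)

(** In the two charts of the blow-up, the equations y_0 = y_1 = 0 of the centre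
    pull back to s = s b = 0, that is, to s = 0. *)
Lemma blowup_adapted (R : realType) (Z Zt : manifold (CC R) 3) (l : set Z)
    (pi : Zt -> Z) y :
  is_blowup l pi -> exceptional_divisor l pi y ->
  exists2 psi, adapted_chart (exceptional_divisor l pi) psi & cdom psi y.
Proof.
move=> [_ _ blow] ly.
have [phi [phi0 [phi1 [[_ a0 a1 py] [lE cover] [_ E0] [_ E1] _]]]] := blow _ ly.
have coverE z : (cdom phi0 `|` cdom phi1) z = cdom phi (pi z) by rewrite cover.
have dom0 z : cdom phi0 z -> cdom phi (pi z) by rewrite -coverE; left.
have dom1 z : cdom phi1 z -> cdom phi (pi z) by rewrite -coverE; right.
move: py; rewrite -coverE.
case=> qy; [exists phi0 => // | exists phi1 => //]; split=> // z qz.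
- apply: (iff_trans (lE _ (dom0 _ qz))); rewrite (E0 _ qz) /row3 !mxE /=.
  by split=> [[]|z0] //; rewrite z0 mul0r.
- apply: (iff_trans (lE _ (dom1 _ qz))); rewrite (E1 _ qz) /row3 !mxE /=.
  by split=> [[]|z0] //; rewrite z0 mul0r.
Qed.

Section SemistableFamily.
Variables (R : realType) (Zt1 Zt2 : manifold (CC R) 3) (Q1 : set Zt1) (Q2 : set Zt2).
Variables (f : Q1 -> Q2) (X : manifold (CC R) 4) (t : X -> CC R).
Variables (i1 : Zt1 -> X) (i2 : Zt2 -> X).
Hypothesis hX : semistable_family f t i1 i2.

Lemma double_locus_image y : Q1 y -> range i2 (i1 y).
Proof.
move=> Qy; have [_ _ _ [_ glue _] _] := hX.
have -> := glue (in_sub (mem_set Qy)).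
by eexists.
Qed.

(** Zt1 is embedded as a closed subset of the central fibre, which is compact
    because the family is proper. *)
Lemma component_compact : compact [set: Zt1].
Proof.
have [_ [eps eps0 [_ proper]] [[[c1 _] inj1 _ cl1] _] [union _ _] _] := hX.
apply: (@compact_of_embedding _ _ i1).
  move=> x B xB; exists (~` (i1 @` (~` B^°))).
    apply: open_nbhs_nbhs; split.
      by apply: closed_openC; apply: cl1; apply: open_closedC; exact: open_interior.
    by move=> [y nBy yx]; apply: nBy; rewrite (inj1 _ _ yx).
  move=> y nBy; apply: contrapT => By; apply: nBy; exists y => // /interior_subset.
  exact: By.
apply: (@subclosed_compact _ _ (t @^-1` [set 0])).
- by apply: cl1; exact: closedT.
- by apply: proper; [exact: compact_set1 | move=> s ->; rewrite /= normr0].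
- by rewrite -union => y ?; left.
Qed.

(** Q1 is the preimage under i1 of the closed set i2(Zt2), hence it is closed in
    the compact space Zt1. *)
Lemma double_locus_compact : compact [set: Q1].
Proof.
have [_ _ [[[c1 _] _ _ _] [_ _ _ cl2]] [_ _ sep] _] := hX.
apply: compact_set_type; apply: (subclosed_compact _ component_compact) => //.
have -> : Q1 = i1 @^-1` range i2.
  apply/seteqP; split=> [y|y [y2 _ e]]; first exact: double_locus_image.
  exact: sep (esym e).
rewrite -openC; apply: (@open_preimage_at _ _ i1 (~` range i2)).
  by rewrite openC; apply: cl2; exact: closedT.
by move=> x _; exact: c1.
Qed.

End SemistableFamily.

Theorem proposition3p14 (R : realType)
  (M1 M2 : riemannian4 R)
  (hM1 : compact [set: M1] /\ anti_self_dual M1)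
  (hM2 : compact [set: M2] /\ anti_self_dual M2)
  (Z1 : twistor_space M1) (Z2 : twistor_space M2) (m1 : M1) (m2 : M2)
  (Zt1 Zt2 : manifold (CC R) 3) (p1 : Zt1 -> Z1) (p2 : Zt2 -> Z2)
  (hp1 : is_blowup (twistor_line Z1 m1) p1)
  (hp2 : is_blowup (twistor_line Z2 m2) p2)
  (Q1 := exceptional_divisor (twistor_line Z1 m1) p1)
  (Q2 := exceptional_divisor (twistor_line Z2 m2) p2)
  (f : Q1 -> Q2) (hf : ruling_exchanging p1 p2 f)
  (X : manifold (CC R) 4) (t : X -> CC R) (i1 : Zt1 -> X) (i2 : Zt2 -> X)
  (hX : semistable_family f t i1 i2)
  (theta : R)
  (c : set Q1) (hc : irreducible_curve [set val x | x in c]) :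
  let P := restrict_circle c (fixed_phase_bundle i1 i2 t Q1 theta) in
  let L := associated_line P in
  vector_family_iso L (restrict_vector c (normal_bundle Q1)) /\
  c1_circle P = c1_line L.
Proof.
move=> P L.
have [_ _ [[si1 _ imi1 _] _] _ [charts _]] := hX.
have Qi2 : forall y, Q1 y -> range i2 (i1 y) := double_locus_image hX.
have Qad : forall y, Q1 y -> exists2 psi, adapted_chart Q1 psi & cdom psi y.
  by move=> y; exact: blowup_adapted.
pose U kappa : set Q1 := fp_base i1 i2 t kappa.
have cover (x : Q1) : exists kappa, U kappa x.
  by have [kappa sk kx] := charts x; exists kappa.
pose tauP kappa : circle_triv P (val @^-1` U kappa) :=
  restrict_circle_triv c (fixed_phase_triv t theta si1 imi1 Qi2 Qad kappa).
pose tauN kappa := normal_triv t si1 imi1 Qi2 Qad kappa.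
pose tauNc kappa := restrict_line_triv c (tauN kappa).
have coverc (b : c) : exists kappa, (val @^-1` U kappa : set c) b.
  exact: cover (val b).
split.
  have [n [nc nZ n0]] := norm_exists tauN cover (double_locus_compact hX)
    (hausdorff_set_type (@mspace_hausdorff _ _ Zt1)).
  apply: (@line_iso_of_norm _ _ _ _ coverc _ _ (fun kappa => assoc_triv (tauP kappa))
    tauNc (fun e => n (val e))).
  - move=> e; apply: (@continuous_at_comp _ _ _
      (fun e : restrict_vector c (normal_bundle Q1) => val e) n).
      exact: continuous_val.
    exact: nc.
  - by move=> a e; rewrite -nZ.
  - by move=> kappa e; exact: n0.
  - move=> kappa kappa' b db db'; exists (unit_ratio i1 kappa kappa' (val (val b))).
    split; first exact: unit_ratio_neq0.
    + move=> e; have [q [z ->]] := assoc_class_surj e.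
      rewrite vproj_assoc_class => qb.
      have vq : cproj (val q) = val b by rewrite -qb.
      have dq : U kappa (cproj (val q)) by rewrite vq.
      have dq' : U kappa' (cproj (val q)) by rewrite vq.
      have T := fp_phase_transition si1 imi1 Qi2 Qad dq dq'.
      rewrite vq in T.
      have E k (dk : U k (cproj (val q))) :
          lt_coord (assoc_triv (tauP k)) (assoc_class (q, z)) =
          val (fp_trivial_phase k (val q)) * z.
        exact: (assoc_coord_class (tauP k)).
      set a := unit_ratio i1 kappa kappa' (val (val b)) in T *.
      have T' : val (fp_trivial_phase kappa' (val q)) =
          a / `|a| * val (fp_trivial_phase kappa (val q)).
        have a0 : a != 0 by exact: unit_ratio_neq0.
        by rewrite T -(val_phase a0).
      apply: etrans (E _ dq') _; apply: etrans (congr1 (fun w => w * z) T') _.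
      apply: etrans (esym (mulrA _ _ _)) _; apply: congr1.
      exact: esym (E _ dq).
    + move=> e eb.
      have vq : vproj (val e) = val b by rewrite -eb.
      have dq : U kappa (vproj (val e)) by rewrite vq.
      have dq' : U kappa' (vproj (val e)) by rewrite vq.
      have := nb_coord_transition si1 imi1 Qi2 Qad dq dq'.
      by rewrite vq.
apply: c1_associated_line => -[a q].
have [kappa dq] := coverc (cproj q).
exact: (circle_triv_act_cont (tauP kappa) dq).
Qed.
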